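(* Let $\Sigma$ be a finite set, $P=(p(x,y))$ an irreducible transition matrix on $\Sigma$ with invariant distribution $\pi$ and mixing time $T$, $\nu$ a probability distribution on $\Sigma$, and $\mu$ a measure on $\Sigma$ with full support. There exists a probability space $(\Omega,\mathcal F,\mathbb Q)$ on which one can construct a Markov chain $(Z_i)_{i\ge0}$ with transition matrix $P$ and initial distribution $\nu$ and an i.i.d. sequence $(U_i)_{i\ge0}$ with marginal $\pi$ such that for every $\varepsilon$ satisfying $$0<\varepsilon\le\frac12\wedge\min_{z\in\Sigma}\frac{\mathrm{Var}_\pi\rho_z}{2\|\rho_z\|_\infty g(z)}$$ and every $n\ge 2k(\varepsilon)T$, $$\mathbb Q[\mathcal G(n,\varepsilon)^c]\le C\sum_{z\in\Sigma}\Big(e^{-cn\varepsilon^2}+e^{-cn\varepsilon\frac{\pi(z)}{\nu(z)}}+\exp\Big\{-\frac{c\,\varepsilon^2g(z)^2}{\mathrm{Var}_\pi\rho_z}\,\frac{n}{k(\varepsilon)T}\Big\}\Big),$$ where $c,C\in(0,\infty)$ are absolute constants, $$\mathcal G(n,\varepsilon)=\big\{\{U_i\}_{i=0}^{n(1-\varepsilon)}\subset\{Z_i\}_{i=0}^n\subset\{U_i\}_{i=0}^{n(1+\varepsilon)}\big\},$$ and $k(\varepsilon)=-\min_{z\in\Sigma}\log_2\frac{\pi_\star\varepsilon^2g(z)^2}{6\,\mathrm{Var}_\pi(\rho_z)}$.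
   Context: The mixing time is $T=\min\{n\ge0:\max_{x\in\Sigma}\|P^n(x,\cdot)-\pi\|_{TV}\le 1/4\}$ with $\|\nu-\nu'\|_{TV}=\frac12\sum_x|\nu(x)-\nu'(x)|$. $\pi_\star=\min_{z\in\Sigma}\pi(z)$. $g(x)=\pi(x)/\mu(x)$, $\rho(x,y)=p(x,y)/\mu(y)$, and $\rho_y$ denotes the function $x\mapsto\rho(x,y)$. For $f:\Sigma\to\mathbb R$, $\pi(f)=\sum_x\pi(x)f(x)$ and $\mathrm{Var}_\pi f=\pi((f-\pi(f))^2)$. Upper indices of sets like $\{U_i\}_{i=0}^{n(1\pm\varepsilon)}$ are understood as integer parts. *)

(* Defs.v *)
From Stdlib Require Import Reals Lra List.
Import ListNotations.
Open Scope R_scope.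

Definition finite_enum {S : Type} (l : list S) : Prop :=
  NoDup l /\ (forall x : S, In x l).

Definition sumS {S : Type} (l : list S) (f : S -> R) : R :=
  fold_right (fun x acc => f x + acc) 0 l.

Definition minS {S : Type} (l : list S) (f : S -> R) : R :=
  match l with
  | [] => 0
  | x :: r => fold_right (fun y acc => Rmin (f y) acc) (f x) r
  end.
Definition maxS {S : Type} (l : list S) (f : S -> R) : R :=
  match l with
  | [] => 0
  | x :: r => fold_right (fun y acc => Rmax (f y) acc) (f x) r
  end.

Definition is_distribution {S : Type} (l : list S) (m : S -> R) : Prop :=
  (forall x, 0 <= m x) /\ sumS l m = 1.

Definition stochastic {S : Type} (l : list S) (P : S -> S -> R) : Prop :=
  (forall x y, 0 <= P x y) /\ (forall x, sumS l (P x) = 1).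

Fixpoint Pn {S : Type} (dec : forall x y : S, {x = y} + {x <> y})
    (l : list S) (P : S -> S -> R) (n : nat) : S -> S -> R :=
  match n with
  | O => fun x y => if dec x y then 1 else 0
  | S m => fun x y => sumS l (fun z => Pn dec l P m x z * P z y)
  end.

Definition irreducible {S : Type} (dec : forall x y : S, {x = y} + {x <> y})
    (l : list S) (P : S -> S -> R) : Prop :=
  forall x y, exists n, 0 < Pn dec l P n x y.

Definition invariant {S : Type} (l : list S) (P : S -> S -> R) (pi : S -> R) : Prop :=
  is_distribution l pi /\ forall y, sumS l (fun x => pi x * P x y) = pi y.

Definition tv {S : Type} (l : list S) (a b : S -> R) : R :=
  / 2 * sumS l (fun x => Rabs (a x - b x)).

Definition is_mixing_time {S : Type} (dec : forall x y : S, {x = y} + {x <> y})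
    (l : list S) (P : S -> S -> R) (pi : S -> R) (T : nat) : Prop :=
  (forall x, tv l (Pn dec l P T x) pi <= / 4) /\
  (forall m, (m < T)%nat -> exists x, / 4 < tv l (Pn dec l P m x) pi).

Definition expect {S : Type} (l : list S) (pi f : S -> R) : R :=
  sumS l (fun x => pi x * f x).
Definition variance {S : Type} (l : list S) (pi f : S -> R) : R :=
  expect l pi (fun x => (f x - expect l pi f) ^ 2).

Definition supnorm {S : Type} (l : list S) (f : S -> R) : R :=
  maxS l (fun x => Rabs (f x)).

Definition gfun {S : Type} (pi mu : S -> R) (x : S) : R := pi x / mu x.
Definition rho {S : Type} (P : S -> S -> R) (mu : S -> R) (x y : S) : R :=
  P x y / mu y.
Definition rho_col {S : Type} (P : S -> S -> R) (mu : S -> R) (y : S) : S -> R :=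
  fun x => rho P mu x y.
Definition pi_star {S : Type} (l : list S) (pi : S -> R) : R := minS l pi.
Definition log2 (x : R) : R := ln x / ln 2.
Definition kfun {S : Type} (l : list S) (P : S -> S -> R) (pi mu : S -> R)
    (eps : R) : R :=
  - minS l (fun z => log2 (pi_star l pi * eps ^ 2 * (gfun pi mu z) ^ 2
                           / (6 * variance l pi (rho_col P mu z)))).

Definition sigma_algebra {Omega : Type} (F : (Omega -> Prop) -> Prop) : Prop :=
  F (fun _ => True) /\
  (forall A, F A -> F (fun w => ~ A w)) /\
  (forall A : nat -> Omega -> Prop, (forall n, F (A n)) ->
     F (fun w => exists n, A n w)).

Definition probability_measure {Omega : Type} (F : (Omega -> Prop) -> Prop)
    (Q : (Omega -> Prop) -> R) : Prop :=
  (forall A, F A -> 0 <= Q A) /\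
  Q (fun _ => True) = 1 /\
  (forall A : nat -> Omega -> Prop,
     (forall n, F (A n)) ->
     (forall n m w, n <> m -> A n w -> A m w -> False) ->
     infinite_sum (fun n => Q (A n)) (Q (fun w => exists n, A n w))).

Definition prob_space {Omega : Type} (F : (Omega -> Prop) -> Prop)
    (Q : (Omega -> Prop) -> R) : Prop :=
  sigma_algebra F /\ probability_measure F Q.

Definition measurable_seq {Omega St : Type} (F : (Omega -> Prop) -> Prop)
    (X : nat -> Omega -> St) : Prop :=
  forall i x, F (fun w => X i w = x).

Fixpoint prodn (f : nat -> R) (m : nat) : R :=
  match m with
  | O => 1
  | S k => prodn f k * f k
  end.

Definition markov_chain {Omega St : Type} (F : (Omega -> Prop) -> Prop)
    (Q : (Omega -> Prop) -> R) (P : St -> St -> R) (nu : St -> R)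
    (Z : nat -> Omega -> St) : Prop :=
  measurable_seq F Z /\
  forall (m : nat) (xs : nat -> St),
    Q (fun w => forall i, (i <= m)%nat -> Z i w = xs i)
    = nu (xs O) * prodn (fun i => P (xs i) (xs (S i))) m.

Definition iid_seq {Omega St : Type} (F : (Omega -> Prop) -> Prop)
    (Q : (Omega -> Prop) -> R) (pi : St -> R) (U : nat -> Omega -> St) : Prop :=
  measurable_seq F U /\
  forall (m : nat) (us : nat -> St),
    Q (fun w => forall i, (i <= m)%nat -> U i w = us i)
    = prodn (fun i => pi (us i)) (S m).

Definition good_event {Omega St : Type} (Z U : nat -> Omega -> St)
    (n : nat) (eps : R) : Omega -> Prop :=
  fun w =>
    (forall i : nat, INR i <= INR n * (1 - eps) ->
       exists j : nat, (j <= n)%nat /\ Z j w = U i w) /\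
    (forall j : nat, (j <= n)%nat ->
       exists i : nat, INR i <= INR n * (1 + eps) /\ U i w = Z j w).

(** exp(-c n eps pi(z)/nu(z)), interpreted as 0 when nu(z) = 0 (ratio = +oo). *)
Definition exp_ratio_term (c : R) (n : nat) (eps piz nuz : R) : R :=
  if Req_EM_T nuz 0 then 0 else exp (- c * INR n * eps * (piz / nuz)).

(* Main.v *)
(** A discrete form of the soft local time method.  Attach to every state [z] an
    independent column of Bernoulli(d) cells, with [d] half the minimum of [pi].  A run
    repeatedly proposes a state [w] drawn from its current transition law and reads the
    next unread cell of column [w]; on a success it moves to [w].  Since every cell is
    read at most once by a run, the successes of the run with law [P] form a Markov
    chain with matrix [P] and those of the run with law [pi] are i.i.d., although both
    runs read the same field.  If one run visits [z] and the other has not, then the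
    second one has met at most as many failures in column [z] as the first.

    With [(1 - d) eta = d theta], the number [F] of failures in column [z] before the
    m-th success satisfies
    [E (1 + eta)^F = E prod_i 1 / (1 - theta P (X_i, z))], as if the failures were
    sums of exponential variables of means [P (X_i, z)].  Splitting the time axis into
    residue classes modulo [L = 4 K T] with [K >= k(eps)], along which the chain
    is nearly i.i.d. with law [pi], gives the Chernoff bound
    [exp (- n tau eps / 4)] for every tilt [tau = |theta| pi z] of order at most
    [eps / (1 + L Var (rho_z) / g(z)^2)]; the first draw, of law [nu], also requires
    [tau <= pi z / (2 nu z)], whence the second term of the theorem. *)
Require Import Defs.
From Stdlib Require Import Reals Arith ZArith Lra Lia List Classical ClassicalEpsilon
  FunctionalExtensionality PropExtensionality FinFun.
From mathcomp Require all_boot all_order all_algebra.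
From mathcomp Require all_classical all_reals all_analysis Rstruct Rstruct_topology.
Open Scope R_scope.

(** Discreteness keeps the coupling elementary. A pair of histories of length N has an explicit
    weight: its two proposal weights times the probability that the field agrees with both sets of
    readings. These weights are consistent in N, so nested intervals of [0,1) realise them, and each
    estimate reduces to finite sums over words. Neither the field nor the two kernels involve n, eps
    or T, so one coupling serves them all.

    A missed state is a large deviation: as the failures of one run are dominated by those of the
    other, at least one count lies on the wrong side of any level placed between their means. The
    means are proportional to the number of draws, and the level corresponds to n(1 - eps/2) or n(1
    + eps/2) draws.

    With [d] half the minimum of pi, d <= pi z (1 - d), which gives |eta| <= tau. The factor 4 in L
    makes the mixing error the fourth power of a quantity below pstar eps^2 / (6 V), V = Var(rho_z)
    / g(z)^2: after division by pstar it is still small against L tau eps. The condition on eps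
    bounds L |theta| p(x,z), so the exponential of a block can be expanded to second order. *)

(** * Lebesgue measure on the unit interval as the underlying probability space *)

Module UnitInterval.
Import all_boot all_order all_algebra all_classical all_reals all_analysis.
Import Rstruct Rstruct_topology.
Import Order.TTheory GRing.Theory Num.Theory numFieldNormedType.Exports.
Local Open Scope classical_set_scope.
Local Open Scope ring_scope.

Definition I01 : set R := `[0%R, 1%R[.
(** The sample space is the whole line, to avoid a subtype; only the trace on [0,1) counts, and
    points outside carry no mass. *)
Definition event (A : R -> Prop) : Prop :=
  measurable ((A : set R) `&` I01 : set (measurableTypeR R)).
Definition prob (A : R -> Prop) : R :=
  fine (lebesgue_measure ((A : set R) `&` I01)).

Lemma measurable_I01 : measurable (I01 : set (measurableTypeR R)).
Proof. exact: measurable_itv. Qed.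

Lemma event_fin (A : R -> Prop) : event A ->
  lebesgue_measure ((A : set R) `&` I01) \is a fin_num.
Proof.
move=> mA; rewrite ge0_fin_numE ?measure_ge0//.
have leA : (lebesgue_measure ((A : set R) `&` I01) <= lebesgue_measure I01)%E.
  apply: le_measure; rewrite ?inE //; exact: measurable_I01.
apply: (le_lt_trans leA).
by rewrite /I01 lebesgue_measure_itv /= lte_fin ltr01 oppr0 adde0 ltry.
Qed.

Lemma prob_sigma_additive (A : nat -> R -> Prop) :
  (forall n, event (A n)) ->
  (forall n m w, n <> m -> A n w -> A m w -> False) ->
  infinite_sum (fun n => prob (A n)) (prob (fun w => exists n, A n w)).
Proof.
move=> mA dA.
pose B n : set (measurableTypeR R) := (A n : set R) `&` I01.
have UB : \bigcup_n B n = ((fun w => exists n, A n w) : set R) `&` I01.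
  apply/seteqP; split => x /=.
    by move=> [n _ [An Ix]]; split=> //; exists n.
  by move=> [[n An] Ix]; exists n.
have mU : event (fun w => exists n, A n w).
  rewrite /event -UB; apply: bigcup_measurable => n _; exact: mA.
have tB : trivIset setT B.
  apply/trivIsetP => i j _ _ ij; apply/seteqP; split => // x [[Ai _] [Aj _]].
  apply: (dA i j x) => // eij; by rewrite eij eqxx in ij.
have := @measure_sigma_additive _ _ _ (@lebesgue_measure R) B mA tB.
rewrite UB => cv.
have {}cv : (fine \o (fun n => \sum_(0 <= i < n) lebesgue_measure (B i))%E) n
    @[n --> \oo] --> (prob (fun w => exists n, A n w) : R^o).
  apply: fine_cvg; rewrite /prob fineK; first exact: cv.
  exact: event_fin.
move=> e /RltP e0.
have /cvgrPdist_lt/(_ e e0) [N _ HN] := cv.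
exists N => n /ssrnat.leP Nn.
have := HN n.+1 (leqW Nn) => /=.
rewrite -sum_fine; last by move=> i _; exact: event_fin.
move=> H; rewrite /Rdist sum_f_R0E RabsE; apply/RltP.
by rewrite distrC.
Qed.

Lemma prob_space_I01 : prob_space event prob.
Proof.
split; split.
- by rewrite /event setTI; exact: measurable_I01.
- split.
    move=> A mA; rewrite /event.
    have -> : ((fun w => ~ A w) : set R) `&` I01 = I01 `\` ((A : set R) `&` I01).
      apply/seteqP; split => x /=; first by move=> [nA Ix]; split=> // -[].
      by move=> [Ix nA]; split => // Ax; apply: nA.
    by apply: measurableD => //; exact: measurable_I01.
  move=> A mA; rewrite /event.
  have -> : ((fun w => exists n, A n w) : set R) `&` I01
    = \bigcup_n ((A n : set R) `&` I01).
    apply/seteqP; split => x /=; first by move=> [[n An] Ix]; exists n.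
    by move=> [n _ [An Ix]]; split=> //; exists n.
  by apply: bigcup_measurable => n _; exact: mA.
- by move=> A mA; apply/RleP; rewrite fine_ge0// measure_ge0.
- split; last exact: prob_sigma_additive.
  by rewrite /prob setTI /I01 lebesgue_measure_itv /= lte_fin ltr01 oppr0 adde0.
Qed.

Lemma event_prob_interval (A : R -> Prop) (a b : R) :
  Rle 0 a -> Rle a b -> Rle b 1 ->
  (forall w, Rle 0 w -> Rlt w 1 -> (A w <-> Rle a w /\ Rlt w b)) ->
  event A /\ prob A = Rminus b a.
Proof.
move=> /RleP a0 /RleP ab /RleP b1 HA.
pose J : set R := [set` `[a, b[].
have JE : J = (A : set R) `&` I01.
  apply/seteqP; split => x /=; rewrite /I01 /= !in_itv /=.
    move=> /andP[ax xb].
    have x0 := le_trans a0 ax.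
    have x1 := lt_le_trans xb b1.
    by split; [apply/HA; [exact/RleP|exact/RltP|split; [exact/RleP|exact/RltP]]|apply/andP].
  move=> [Ax /andP[/RleP x0 /RltP x1]]; have [ax xb] := (HA x x0 x1).1 Ax.
  by apply/andP; split; [exact/RleP|exact/RltP].
rewrite /event /prob -JE /J; split; first exact: measurable_itv.
rewrite lebesgue_measure_itv /= lte_fin.
by case: ltgtP ab => //= -> _; rewrite ?RminusE subrr.
Qed.
End UnitInterval.

(** The interface to measure theory: everything after it uses only the axioms of a probability space
    and the measure of half-open intervals. Half-open intervals are chosen because they tile [0,1)
    exactly. *)
Lemma unit_interval_prob_space :
  exists (F : (R -> Prop) -> Prop) (Q : (R -> Prop) -> R), prob_space F Q /\
  forall (A : R -> Prop) (a b : R), 0 <= a -> a <= b -> b <= 1 ->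
    (forall w, 0 <= w -> w < 1 -> (A w <-> a <= w /\ w < b)) ->
    F A /\ Q A = b - a.
Proof.
  exists UnitInterval.event, UnitInterval.prob. split.
  - exact UnitInterval.prob_space_I01.
  - exact UnitInterval.event_prob_interval.
Qed.

Import ListNotations.

(** * Finite sums and elementary probability *)

Ltac sext := apply functional_extensionality; intro.

Lemma sumS_cons {A} (a : A) l f : sumS (a :: l) f = f a + sumS l f.
Proof. reflexivity. Qed.

Lemma sumS_nil {A} (f : A -> R) : sumS [] f = 0.
Proof. reflexivity. Qed.

Lemma sumS_ext {A} (l : list A) f g :
  (forall x, In x l -> f x = g x) -> sumS l f = sumS l g.
Proof.
  induction l as [|a l IH]; intro H; [reflexivity|].
  rewrite !sumS_cons, H, IH; auto with datatypes.
Qed.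

Lemma sumS_le {A} (l : list A) f g :
  (forall x, In x l -> f x <= g x) -> sumS l f <= sumS l g.
Proof.
  induction l as [|a l IH]; intro H; [apply Rle_refl|].
  rewrite !sumS_cons. apply Rplus_le_compat; auto with datatypes.
Qed.

Lemma sumS_zero {A} (l : list A) : sumS l (fun _ => 0) = 0.
Proof. induction l as [|a l IH]; [reflexivity|]. rewrite sumS_cons, IH. ring. Qed.

Lemma sumS_nonneg {A} (l : list A) f :
  (forall x, In x l -> 0 <= f x) -> 0 <= sumS l f.
Proof. intro H. rewrite <- (sumS_zero l). now apply sumS_le. Qed.

Lemma sumS_plus {A} (l : list A) f g :
  sumS l (fun x => f x + g x) = sumS l f + sumS l g.
Proof.
  induction l as [|a l IH]; [rewrite !sumS_nil; ring|]. rewrite !sumS_cons, IH. ring.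
Qed.

Lemma sumS_scal {A} (l : list A) c f :
  sumS l (fun x => c * f x) = c * sumS l f.
Proof.
  induction l as [|a l IH]; [rewrite !sumS_nil; ring|]. rewrite !sumS_cons, IH. ring.
Qed.

Lemma sumS_scal_r {A} (l : list A) c f :
  sumS l (fun x => f x * c) = sumS l f * c.
Proof.
  induction l as [|a l IH]; [rewrite !sumS_nil; ring|]. rewrite !sumS_cons, IH. ring.
Qed.

Lemma sumS_minus {A} (l : list A) f g :
  sumS l (fun x => f x - g x) = sumS l f - sumS l g.
Proof.
  induction l as [|a l IH]; [rewrite !sumS_nil; ring|]. rewrite !sumS_cons, IH. ring.
Qed.

Lemma sumS_swap {A B} (l : list A) (l' : list B) f :
  sumS l (fun x => sumS l' (fun y => f x y)) = sumS l' (fun y => sumS l (fun x => f x y)).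
Proof.
  induction l as [|a l IH].
  - rewrite sumS_nil. cbn. now rewrite sumS_zero.
  - rewrite sumS_cons, IH, <- sumS_plus. reflexivity.
Qed.

Lemma sumS_app {A} (l l' : list A) f : sumS (l ++ l') f = sumS l f + sumS l' f.
Proof.
  induction l as [|a l IH]; [cbn [app]; rewrite sumS_nil; ring|]. cbn [app]. rewrite !sumS_cons, IH. ring.
Qed.

Lemma sumS_map {A B} (h : A -> B) l f : sumS (map h l) f = sumS l (fun x => f (h x)).
Proof.
  induction l as [|a l IH]; [reflexivity|]. cbn [map]. now rewrite !sumS_cons, IH.
Qed.

Lemma sumS_list_prod {A B} (l : list A) (l' : list B) f :
  sumS (list_prod l l') f = sumS l (fun a => sumS l' (fun b => f (a, b))).
Proof.
  induction l as [|a l IH]; [reflexivity|].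
  cbn [list_prod]. now rewrite sumS_app, sumS_map, IH, sumS_cons.
Qed.

Lemma sumS_ge_term {A} (l : list A) f x :
  (forall y, In y l -> 0 <= f y) -> In x l -> f x <= sumS l f.
Proof.
  induction l as [|a l IH]; intros H Hx; [easy|].
  rewrite sumS_cons.
  assert (0 <= f a) by auto with datatypes.
  assert (0 <= sumS l f) by (apply sumS_nonneg; auto with datatypes).
  destruct Hx as [<-|Hx]; [lra|].
  assert (f x <= sumS l f) by (apply IH; auto with datatypes). lra.
Qed.

Lemma sumS_single {A} (l : list A) f x :
  NoDup l -> In x l -> (forall y, In y l -> y <> x -> f y = 0) -> sumS l f = f x.
Proof.
  induction l as [|a l IH]; intros Hl Hx H; [easy|].
  inversion Hl; subst. rewrite sumS_cons. destruct Hx as [->|Hx].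
  - rewrite (sumS_ext l f (fun _ => 0)), sumS_zero; [ring|].
    intros y Hy. apply H; [auto with datatypes|]. now intros ->.
  - rewrite IH; auto with datatypes.
    rewrite (H a); [ring|auto with datatypes|]. now intros ->.
Qed.

Lemma sumS_Rabs {A} (l : list A) f : Rabs (sumS l f) <= sumS l (fun x => Rabs (f x)).
Proof.
  induction l as [|a l IH]; [rewrite !sumS_nil, Rabs_R0; lra|].
  rewrite !sumS_cons. eapply Rle_trans; [apply Rabs_triang|]. lra.
Qed.

Definition ind (P : Prop) : R := if excluded_middle_informative P then 1 else 0.

Lemma ind_true P : P -> ind P = 1.
Proof. unfold ind. now destruct excluded_middle_informative. Qed.

Lemma ind_false P : ~ P -> ind P = 0.
Proof. unfold ind. now destruct excluded_middle_informative. Qed.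

Lemma ind_bounds P : 0 <= ind P <= 1.
Proof. unfold ind. destruct excluded_middle_informative; lra. Qed.

Lemma ind_le P Q : (P -> Q) -> ind P <= ind Q.
Proof. unfold ind. repeat destruct excluded_middle_informative; intuition lra. Qed.

Section Words.
Context {A : Type} (lA : list A).

(* Words are written backwards: the most recent letter comes first. *)
Fixpoint words (N : nat) : list (list A) :=
  match N with
  | O => [nil]
  | S N' => map (fun p => fst p :: snd p) (list_prod lA (words N'))
  end.

Lemma sumS_words_S N (f : list A -> R) :
  sumS (words (S N)) f = sumS (words N) (fun s => sumS lA (fun a => f (a :: s))).
Proof. cbn [words]. now rewrite sumS_map, sumS_list_prod, sumS_swap. Qed.

Lemma words_length N s : In s (words N) -> length s = N.
Proof.
  revert s; induction N as [|N IH]; intros s Hs.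
  - destruct Hs as [<-|[]]; reflexivity.
  - apply in_map_iff in Hs as [[a t] [<- Ht]]. apply in_prod_iff in Ht.
    cbn. now rewrite IH.
Qed.

Lemma words_full N s : (forall x, In x lA) -> length s = N -> In s (words N).
Proof.
  intro HA. revert s; induction N as [|N IH]; intros [|a s] Hs; try easy.
  - now left.
  - apply in_map_iff. exists (a, s). split; [reflexivity|].
    apply in_prod; [auto|]. apply IH. now injection Hs.
Qed.

Lemma NoDup_list_prod {B C} (l : list B) (l' : list C) :
  NoDup l -> NoDup l' -> NoDup (list_prod l l').
Proof.
  intros Hl Hl'. induction Hl as [|b l Hb Hl IH]; [constructor|].
  cbn [list_prod]. apply NoDup_app; [|exact IH|].
  - apply FinFun.Injective_map_NoDup; [|exact Hl']. intros x y H. now injection H.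
  - intros [x y] Hx H2. apply in_prod_iff in H2. apply in_map_iff in Hx as [c [Hc _]].
    injection Hc as -> ->. tauto.
Qed.

Lemma NoDup_words N : NoDup lA -> NoDup (words N).
Proof.
  intro HA. induction N as [|N IH]; [repeat constructor; easy|].
  apply FinFun.Injective_map_NoDup; [|now apply NoDup_list_prod].
  intros [a s] [b t] H. cbn in H. now injection H as -> ->.
Qed.
End Words.

Section Probability.
Context {Omega : Type} (F : (Omega -> Prop) -> Prop) (Q : (Omega -> Prop) -> R).
Hypothesis HP : prob_space F Q.

Lemma event_ext (A B : Omega -> Prop) : (forall w, A w <-> B w) -> A = B.
Proof. intro H. sext. now apply propositional_extensionality. Qed.

Lemma F_true : F (fun _ => True).
Proof. apply HP. Qed.

Lemma F_not A : F A -> F (fun w => ~ A w).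
Proof. apply HP. Qed.

Lemma F_ex (A : nat -> Omega -> Prop) :
  (forall n, F (A n)) -> F (fun w => exists n, A n w).
Proof. apply HP. Qed.

Lemma F_const (P : Prop) : F (fun _ => P).
Proof.
  destruct (classic P) as [H|H].
  - rewrite (event_ext _ (fun _ => True)); [apply F_true|tauto].
  - rewrite (event_ext _ (fun _ => ~ True)); [apply F_not, F_true|tauto].
Qed.

Lemma F_or A B : F A -> F B -> F (fun w => A w \/ B w).
Proof.
  intros HA HB.
  rewrite (event_ext _ (fun w => exists n : nat, match n with O => A w | _ => B w end)).
  - apply (F_ex (fun n w => match n with O => A w | _ => B w end)).
    now intros [|n].
  - intro w; split.
    + intros [H|H]; [now exists 0%nat|now exists 1%nat].
    + intros [[|n] H]; tauto.
Qed.

Lemma F_and A B : F A -> F B -> F (fun w => A w /\ B w).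
Proof.
  intros HA HB. rewrite (event_ext _ (fun w => ~ (~ A w \/ ~ B w))).
  - apply F_not, F_or; now apply F_not.
  - intro w. destruct (classic (A w)), (classic (B w)); tauto.
Qed.

Lemma F_imp A B : F A -> F B -> F (fun w => A w -> B w).
Proof.
  intros HA HB. rewrite (event_ext _ (fun w => ~ A w \/ B w)).
  - apply F_or; [now apply F_not|exact HB].
  - intro w. destruct (classic (A w)); tauto.
Qed.

Lemma F_all (A : nat -> Omega -> Prop) :
  (forall n, F (A n)) -> F (fun w => forall n, A n w).
Proof.
  intro HA. rewrite (event_ext _ (fun w => ~ exists n, ~ A n w)).
  - apply F_not. apply (F_ex (fun n w => ~ A n w)). intro n. now apply F_not.
  - intro w; split; [firstorder|]. intros H n. apply NNPP. firstorder.
Qed.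

Lemma F_ex_list {B} (l : list B) (A : B -> Omega -> Prop) :
  (forall b, F (A b)) -> F (fun w => exists b, In b l /\ A b w).
Proof.
  intro HA. induction l as [|b l IH].
  - rewrite (event_ext _ (fun _ => False)); [apply F_const|firstorder].
  - rewrite (event_ext _ (fun w => A b w \/ exists b, In b l /\ A b w)).
    + now apply F_or.
    + intro w; split.
      * intros [c [[<-|Hc] H]]; [now left|right; now exists c].
      * intros [H|[c [Hc H]]]; [exists b|exists c]; auto with datatypes.
Qed.

Lemma Q_nonneg A : F A -> 0 <= Q A.
Proof. apply HP. Qed.

(** Sigma-additivity for a constant sequence of empty events makes the multiples of q = Q(empty)
    converge to q, which is impossible unless q = 0. *)
Lemma Q_false : Q (fun _ => False) = 0.
Proof.
  destruct HP as [_ [_ [_ Hs]]].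
  specialize (Hs (fun _ _ => False) (fun _ => F_const False)).
  assert (Hs' := Hs ltac:(tauto)). cbn beta in Hs'.
  replace (fun _ : Omega => exists _ : nat, False) with (fun _ : Omega => False) in Hs'
    by (apply event_ext; intro; firstorder).
  set (q := Q (fun _ => False)) in *.
  apply NNPP; intro Hq.
  assert (Hsum : forall n, sum_f_R0 (fun _ => q) n = INR (S n) * q).
  { induction n as [|n IH]; [cbn; ring|]. cbn [sum_f_R0]. rewrite IH, !S_INR. ring. }
  destruct (Hs' (Rabs q) (Rabs_pos_lt _ Hq)) as [N HN].
  specialize (HN (S N) ltac:(lia)). rewrite Hsum in HN. unfold Rdist in HN.
  replace (INR (S (S N)) * q - q) with (INR (S N) * q) in HN by (rewrite (S_INR (S N)); ring).
  rewrite Rabs_mult, (Rabs_pos_eq (INR (S N))) in HN by apply pos_INR.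
  assert (1 <= INR (S N)) by (rewrite S_INR; pose proof (pos_INR N); lra).
  pose proof (Rabs_pos q). nra.
Qed.

Lemma Q_or A B : F A -> F B -> (forall w, A w -> B w -> False) ->
  Q (fun w => A w \/ B w) = Q A + Q B.
Proof.
  intros HA HB Hd. destruct HP as [_ [_ [_ Hs]]].
  set (E := fun (n : nat) w => match n with O => A w | S O => B w | _ => False end).
  assert (HE : forall n, F (E n)).
  { intros [|[|n]]; try assumption. exact (F_const False). }
  assert (H := Hs E HE).
  rewrite (event_ext (fun w => exists n, E n w) (fun w => A w \/ B w)) in H.
  2:{ intro w; split.
      - intros [[|[|n]] Hn]; cbn in Hn; tauto.
      - intros [Hw|Hw]; [now exists 0%nat|now exists 1%nat]. }
  assert (Hlim : infinite_sum (fun n => Q (E n)) (Q A + Q B)).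
  { intros e He. exists 1%nat. intros n Hn.
    replace (sum_f_R0 (fun n => Q (E n)) n) with (Q A + Q B); [rewrite Rdist_eq; exact He|].
    induction n as [|n IH]; [lia|]. cbn [sum_f_R0].
    destruct n as [|n]; [reflexivity|]. rewrite <- IH by lia.
    change (Q (E (S (S n)))) with (Q (fun _ => False)). rewrite Q_false. ring. }
  eapply uniqueness_sum; [apply H|exact Hlim].
  intros [|[|n]] [|[|m]] w Hnm H1 H2; cbn in *; try tauto; try lia; eauto.
Qed.

Lemma Q_le A B : F A -> F B -> (forall w, A w -> B w) -> Q A <= Q B.
Proof.
  intros HA HB H.
  rewrite (event_ext B (fun w => A w \/ (B w /\ ~ A w))).
  - rewrite Q_or; [|exact HA|apply F_and; [exact HB|now apply F_not]|tauto].
    assert (0 <= Q (fun w => B w /\ ~ A w)); [|lra].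
    apply Q_nonneg, F_and; [exact HB|now apply F_not].
  - intro w. specialize (H w). destruct (classic (A w)); tauto.
Qed.

Lemma Q_or_le A B : F A -> F B -> Q (fun w => A w \/ B w) <= Q A + Q B.
Proof.
  intros HA HB. rewrite (event_ext _ (fun w => A w \/ (B w /\ ~ A w))).
  - assert (F (fun w => B w /\ ~ A w)) by (apply F_and; [exact HB|now apply F_not]).
    rewrite Q_or; try assumption; [|tauto].
    assert (Q (fun w => B w /\ ~ A w) <= Q B); [|lra].
    apply Q_le; try assumption. tauto.
  - intro w. destruct (classic (A w)); tauto.
Qed.

Lemma Q_discrete {B} (Y : Omega -> B) (l : list B) (p : B -> R) (phi : B -> Prop) :
  NoDup l -> (forall b, In b l -> F (fun w => Y w = b) /\ Q (fun w => Y w = b) = p b) ->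
  F (fun w => In (Y w) l /\ phi (Y w)) /\
  Q (fun w => In (Y w) l /\ phi (Y w)) = sumS l (fun b => p b * ind (phi b)).
Proof.
  intros Hl Hp. induction Hl as [|b l Hb Hl IH].
  - rewrite (event_ext _ (fun _ => False)) by (cbn; tauto).
    split; [apply F_const|apply Q_false].
  - destruct IH as [IH1 IH2]; [auto with datatypes|].
    destruct (Hp b) as [Hb1 Hb2]; [auto with datatypes|].
    assert (HF : F (fun w => Y w = b /\ phi b)) by (apply F_and; [exact Hb1|apply F_const]).
    rewrite (event_ext _ (fun w => (Y w = b /\ phi b) \/ (In (Y w) l /\ phi (Y w)))).
    + split; [now apply F_or|].
      rewrite Q_or; try assumption.
      * rewrite sumS_cons, IH2. f_equal. destruct (classic (phi b)) as [H|H].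
        -- rewrite ind_true, <- Hb2 by assumption.
           rewrite (event_ext _ (fun w => Y w = b)); [ring|tauto].
        -- rewrite ind_false by assumption.
           rewrite (event_ext _ (fun w => False)); [rewrite Q_false; ring|tauto].
      * intros w [-> _] [H _]. tauto.
    + intro w; cbn; split.
      * intros [[->|H] H2]; tauto.
      * intros [[-> H]|H]; tauto.
Qed.
End Probability.

(** * A process with prescribed consistent cylinder weights, read off a uniform point *)

Section NestedIntervals.
Context {A : Type} (lA : list A) (a0 : A) (q : list A -> R).
Hypothesis HlA : finite_enum lA.
Hypothesis q_nil : q [] = 1.
Hypothesis q_nonneg : forall s, 0 <= q s.
Hypothesis q_cons : forall s, sumS lA (fun a => q (a :: s)) = q s.

(** [acc] is the left end of the part not yet scanned. The default [a0] is reached only when [w]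
    lies to the right of all the remaining subintervals. *)
Fixpoint pick_letter (l : list A) (acc w : R) (s : list A) : A :=
  match l with
  | [] => a0
  | b :: r => if Rlt_dec w (acc + q (b :: s)) then b
              else pick_letter r (acc + q (b :: s)) w s
  end.

Fixpoint letter_offset (l : list A) (a : A) (s : list A) : R :=
  match l with
  | [] => 0
  | b :: r => if excluded_middle_informative (b = a) then 0
              else q (b :: s) + letter_offset r a s
  end.

Lemma letter_offset_nonneg l a s : 0 <= letter_offset l a s.
Proof.
  induction l as [|b r IH]; cbn [letter_offset]; [lra|].
  destruct excluded_middle_informative; [lra|]. pose proof (q_nonneg (b :: s)). lra.
Qed.

Lemma letter_offset_le l a s :
  In a l -> letter_offset l a s + q (a :: s) <= sumS l (fun b => q (b :: s)).
Proof.
  induction l as [|b r IH]; intro H; [easy|]. rewrite sumS_cons. cbn [letter_offset].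
  destruct excluded_middle_informative as [->|n].
  - assert (0 <= sumS r (fun b => q (b :: s))) by (apply sumS_nonneg; auto). lra.
  - destruct H as [H|H]; [easy|]. specialize (IH H). lra.
Qed.

Lemma pick_letter_In l acc w s :
  acc <= w -> w < acc + sumS l (fun b => q (b :: s)) -> In (pick_letter l acc w s) l.
Proof.
  revert acc; induction l as [|b r IH]; intros acc H1 H2.
  - rewrite sumS_nil in H2. lra.
  - rewrite sumS_cons in H2. cbn [pick_letter].
    destruct Rlt_dec; [now left|right]. apply IH; lra.
Qed.

Lemma pick_letter_iff l acc w s a :
  NoDup l -> In a l -> acc <= w -> w < acc + sumS l (fun b => q (b :: s)) ->
  (pick_letter l acc w s = a <->
   acc + letter_offset l a s <= w /\ w < acc + letter_offset l a s + q (a :: s)).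
Proof.
  intro Hl; revert acc; induction Hl as [|b r Hb Hr IH]; intros acc Ha H1 H2; [easy|].
  rewrite sumS_cons in H2. cbn [pick_letter letter_offset].
  destruct (excluded_middle_informative (b = a)) as [->|n].
  - destruct Rlt_dec as [H|H]; [split; [lra|easy]|].
    split; [|lra]. intro E. exfalso; apply Hb. rewrite <- E. apply pick_letter_In; lra.
  - destruct Ha as [Ha|Ha]; [easy|].
    destruct Rlt_dec as [H|H].
    + split; [easy|]. pose proof (letter_offset_nonneg r a s). lra.
    + rewrite IH by (assumption || lra).
      rewrite !Rplus_assoc. tauto.
Qed.

(** The cylinder of the word s is the interval [[left_end] s, [left_end] s + [q] s), cut into the
    cylinders of its one-letter extensions in the order of [lA]. *)
Fixpoint left_end (s : list A) : R :=
  match s with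
  | [] => 0
  | a :: s' => left_end s' + letter_offset lA a s'
  end.

Lemma left_end_bounds s : 0 <= left_end s /\ left_end s + q s <= 1.
Proof.
  induction s as [|a s [IH1 IH2]]; cbn [left_end].
  - rewrite q_nil. lra.
  - pose proof (letter_offset_nonneg lA a s).
    pose proof (letter_offset_le lA a s (proj2 HlA a)). rewrite q_cons in *. lra.
Qed.

Fixpoint digits (N : nat) (w : R) : list A :=
  match N with
  | O => []
  | S N' => pick_letter lA (left_end (digits N' w)) w (digits N' w) :: digits N' w
  end.

Lemma digits_length N w : length (digits N w) = N.
Proof. induction N; cbn; congruence. Qed.

Lemma digits_iff s w : 0 <= w -> w < 1 ->
  (digits (length s) w = s <-> left_end s <= w /\ w < left_end s + q s).
Proof.
  intros H0 H1. induction s as [|a s IH].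
  - cbn. rewrite q_nil. split; [lra|easy].
  - cbn [length digits left_end].
    pose proof (letter_offset_nonneg lA a s).
    pose proof (letter_offset_le lA a s (proj2 HlA a)) as Hle. rewrite q_cons in Hle.
    split.
    + intro E. injection E as E1 E2. rewrite E2 in E1. apply IH in E2.
      apply pick_letter_iff in E1; [lra|apply HlA|apply HlA|lra|rewrite q_cons; lra].
    + intro E. assert (E2 : digits (length s) w = s) by (apply IH; lra).
      rewrite E2. f_equal. apply IH in E2.
      apply pick_letter_iff; [apply HlA|apply HlA|lra|rewrite q_cons; lra|lra].
Qed.

(** A Kolmogorov extension in explicit form: [q_cons] is the consistency condition, and the
    cylinders of words of length N partition [0,1) into intervals of lengths [q]. *)
Lemma letter_process :
  exists (F : (R -> Prop) -> Prop) (Q : (R -> Prop) -> R), prob_space F Q /\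
  forall N (phi : list A -> Prop),
    F (fun w => phi (digits N w)) /\
    Q (fun w => phi (digits N w)) = sumS (words lA N) (fun s => q s * ind (phi s)).
Proof.
  destruct unit_interval_prob_space as [F [Q [HP HI]]].
  exists F, Q. split; [exact HP|]. intros N phi.
  destruct (Q_discrete F Q HP (digits N) (words lA N) q phi) as [H1 H2].
  - apply NoDup_words, HlA.
  - intros s Hs. apply words_length in Hs. subst N.
    pose proof (left_end_bounds s) as [B1 B2].
    pose proof (q_nonneg s).
    destruct (HI (fun w => digits (length s) w = s) (left_end s) (left_end s + q s))
      as [HF HQ]; try lra.
    + intros w Hw1 Hw2. now apply digits_iff.
    + split; [exact HF|rewrite HQ; ring].
  - assert (E : (fun w => In (digits N w) (words lA N) /\ phi (digits N w))
                = (fun w => phi (digits N w))).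
    { apply event_ext. intro w. split; [tauto|]. intro H. split; [|exact H].
      apply words_full; [apply HlA|apply digits_length]. }
    rewrite E in H1, H2. tauto.
Qed.
End NestedIntervals.

(** * The two runs and their joint law *)

Definition prodS {A} (l : list A) (f : A -> R) : R :=
  fold_right (fun x acc => f x * acc) 1 l.

Lemma prodS_cons {A} (a : A) l f : prodS (a :: l) f = f a * prodS l f.
Proof. reflexivity. Qed.

Lemma prodS_ext {A} (l : list A) f g :
  (forall x, In x l -> f x = g x) -> prodS l f = prodS l g.
Proof.
  induction l as [|a l IH]; intro H; [reflexivity|].
  rewrite !prodS_cons, H, IH; auto with datatypes.
Qed.

Lemma prodS_nonneg {A} (l : list A) f : (forall x, 0 <= f x) -> 0 <= prodS l f.
Proof.
  intro H. induction l as [|a l IH]; [cbn; lra|].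
  rewrite prodS_cons. now apply Rmult_le_pos.
Qed.

Lemma prodS_neq0 {A} (l : list A) f x : In x l -> prodS l f <> 0 -> f x <> 0.
Proof.
  induction l as [|a l IH]; intros Hx H E; [easy|]. rewrite prodS_cons in H.
  destruct Hx as [->|Hx].
  - apply H. rewrite E. ring.
  - apply IH; auto. intro E'. apply H. rewrite E'. ring.
Qed.

Lemma prodS_one {A} (l : list A) : prodS l (fun _ => 1) = 1.
Proof. induction l as [|a l IH]; [reflexivity|]. rewrite prodS_cons, IH. ring. Qed.

Lemma prodS_add_factor {A} (l : list A) f g h x :
  NoDup l -> In x l -> (forall y, y <> x -> f y = h y /\ g y = h y) ->
  f x + g x = h x -> prodS l f + prodS l g = prodS l h.
Proof.
  intros Hl Hx Hne Heq. induction Hl as [|a l Ha Hl IH]; [easy|].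
  rewrite !prodS_cons. destruct Hx as [->|Hx].
  - rewrite (prodS_ext l f h), (prodS_ext l g h), <- Heq; [ring| |];
      intros y Hy; apply Hne; intros ->; tauto.
  - destruct (Hne a) as [-> ->]; [intros ->; tauto|]. rewrite <- IH by assumption. ring.
Qed.

Lemma prodS_scale_factor {A} (l : list A) f g c x :
  NoDup l -> In x l -> (forall y, y <> x -> f y = g y) ->
  f x = c * g x -> prodS l f = c * prodS l g.
Proof.
  intros Hl Hx Hne Heq. induction Hl as [|a l Ha Hl IH]; [easy|].
  rewrite !prodS_cons. destruct Hx as [->|Hx].
  - rewrite (prodS_ext l f g), Heq; [ring|].
    intros y Hy; apply Hne; intros ->; tauto.
  - rewrite (Hne a) by (intros ->; tauto). rewrite IH by assumption. ring.
Qed.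

Lemma sumS_words_prod {A B} (l : list A) (l' : list B) N (H : list A -> list B -> R) :
  sumS (words (list_prod l l') N) (fun s => H (map fst s) (map snd s))
  = sumS (words l N) (fun g => sumS (words l' N) (fun g' => H g g')).
Proof.
  revert H; induction N as [|N IH]; intro H; [cbn; ring|].
  rewrite !sumS_words_S. cbn [map].
  rewrite (IH (fun g g' => sumS (list_prod l l') (fun a => H (fst a :: g) (snd a :: g')))).
  apply sumS_ext; intros g _.
  transitivity (sumS (words l' N)
    (fun g' => sumS l (fun a => sumS l' (fun b => H (a :: g) (b :: g'))))).
  - apply sumS_ext; intros g' _. cbn beta. now rewrite sumS_list_prod.
  - rewrite sumS_swap. apply sumS_ext; intros a _. now rewrite sumS_words_S.
Qed.

Section Ticks.
Context {St : Type} (dec : forall x y : St, {x = y} + {x <> y}) (l : list St) (d : R).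
Hypothesis Hl : finite_enum l.
Hypothesis Hd : 0 < d < 1.

(* A tick [(w, b)] of a run proposes the state [w] and reads the next unread cell
   of column [w] of a Bernoulli([d]) field, finding [b]; the run moves to [w] when [b]
   is true.  A history lists its ticks with the most recent first. *)
Local Notation tick := (St * bool)%type.
Definition ticks : list tick := list_prod l [true; false].
Definition coin (b : bool) : R := if b then d else 1 - d.

Lemma coin_pos b : 0 < coin b.
Proof. destruct b; cbn; lra. Qed.

Lemma sumS_ticks f : sumS ticks f = sumS l (fun w => f (w, true) + f (w, false)).
Proof.
  unfold ticks. rewrite sumS_list_prod. apply sumS_ext; intros w _.
  rewrite !sumS_cons, sumS_nil. ring.
Qed.

Fixpoint succs (g : list tick) : list St :=
  match g with
  | [] => []
  | (w, b) :: g' => if b then w :: succs g' else succs g'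
  end.

Fixpoint reads (z : St) (g : list tick) : list bool :=
  match g with
  | [] => []
  | (w, b) :: g' => if dec w z then b :: reads z g' else reads z g'
  end.

Fixpoint bern (r : list bool) : R :=
  match r with [] => 1 | b :: t => coin b * bern t end.

(* Probability that the cells of one column begin with both [r] and [r']. *)
Fixpoint agree (r r' : list bool) : R :=
  match r with
  | [] => bern r'
  | a :: t => match r' with
              | [] => bern r
              | b :: t' => if Bool.eqb a b then coin a * agree t t' else 0
              end
  end.

Lemma bern_pos r : 0 < bern r.
Proof.
  induction r as [|b r IH]; cbn; [lra|]. apply Rmult_lt_0_compat; [apply coin_pos|exact IH].
Qed.

Lemma bern_snoc r b : bern (r ++ [b]) = coin b * bern r.
Proof. induction r as [|a r IH]; cbn; [ring|]. rewrite IH. ring. Qed.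

Lemma agree_nonneg r r' : 0 <= agree r r'.
Proof.
  revert r'; induction r as [|a r IH]; intros [|b r']; cbn [agree].
  - left; apply bern_pos.
  - left; apply bern_pos.
  - left; apply bern_pos.
  - destruct Bool.eqb; [|lra]. apply Rmult_le_pos; [left; apply coin_pos|apply IH].
Qed.

Lemma agree_sym r r' : agree r r' = agree r' r.
Proof.
  revert r'; induction r as [|a r IH]; intros [|b r']; try reflexivity.
  cbn [agree]. rewrite IH. destruct a, b; reflexivity.
Qed.

(** If the new cell lies within [r], exactly one of its two values is compatible; otherwise the cell
    is fresh and the two coin probabilities add up to 1. *)
Lemma agree_snoc r r' :
  agree r (r' ++ [true]) + agree r (r' ++ [false]) = agree r r'.
Proof.
  revert r'; induction r as [|a r IH]; intros r'.
  - cbn [agree]. rewrite !bern_snoc. cbn [coin]. ring.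
  - destruct r' as [|b r'].
    + cbn [app agree]. rewrite (agree_sym r []). destruct a; cbn; ring.
    + cbn [app agree]. destruct Bool.eqb; [|ring]. rewrite <- (IH r'). ring.
Qed.

(** Were f > h, the cell of index h would have to be a failure for one reader and a success for the
    other. *)
Lemma agree_first_true f h r r' :
  agree (repeat false f ++ r) (repeat false h ++ true :: r') <> 0 -> (f <= h)%nat.
Proof.
  revert h; induction f as [|f IH]; intros h H; [lia|].
  destruct h as [|h]; cbn in H; [lra|].
  apply le_n_S, IH. intro E. apply H. rewrite E. ring.
Qed.

(** Probability that the field shows what both histories have read. Columns are independent, hence
    the product; reversal puts the cells of a column in the order in which they are read. *)
Definition field_wt (g g' : list tick) : R :=
  prodS l (fun z => agree (rev (reads z g)) (rev (reads z g'))).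

Lemma field_wt_sym g g' : field_wt g g' = field_wt g' g.
Proof. apply prodS_ext; intros z _. apply agree_sym. Qed.

Lemma field_wt_nil : field_wt [] [] = 1.
Proof. apply prodS_one. Qed.

Lemma field_wt_nonneg g g' : 0 <= field_wt g g'.
Proof. apply prodS_nonneg; intro; apply agree_nonneg. Qed.

Lemma field_wt_step g g' w :
  field_wt g ((w, true) :: g') + field_wt g ((w, false) :: g') = field_wt g g'.
Proof.
  apply prodS_add_factor with w; try apply Hl; cbn [reads].
  - intros y Hy. destruct (dec w y); [now subst|easy].
  - destruct (dec w w); [|easy]. apply agree_snoc.
Qed.

Lemma field_wt_coin g w b : field_wt [] ((w, b) :: g) = coin b * field_wt [] g.
Proof.
  apply prodS_scale_factor with w; try apply Hl; cbn [reads].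
  - intros y Hy. destruct (dec w y); [now subst|easy].
  - destruct (dec w w); [|easy]. apply bern_snoc.
Qed.

(** [None] is the situation before the first success, so [K None] is the initial law and
    [K (Some x)] the law of a step from x. *)
Definition kernel (K : option St -> St -> R) : Prop :=
  (forall o w, 0 <= K o w) /\ (forall o, sumS l (K o) = 1).

Fixpoint cand_wt (K : option St -> St -> R) (g : list tick) : R :=
  match g with
  | [] => 1
  | (w, b) :: g' => cand_wt K g' * K (hd_error (succs g')) w
  end.

Fixpoint run_wt (K : option St -> St -> R) (g : list tick) : R :=
  match g with
  | [] => 1
  | (w, b) :: g' => run_wt K g' * K (hd_error (succs g')) w * coin b
  end.

Lemma cand_wt_nonneg K g : kernel K -> 0 <= cand_wt K g.
Proof.
  intros [HK _]. induction g as [|[w b] g IH]; cbn; [lra|]. now apply Rmult_le_pos.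
Qed.

Lemma run_wt_nonneg K g : kernel K -> 0 <= run_wt K g.
Proof.
  intros [HK _]. induction g as [|[w b] g IH]; cbn; [lra|].
  apply Rmult_le_pos; [now apply Rmult_le_pos|]. left; apply coin_pos.
Qed.

Lemma run_wtE K g : cand_wt K g * field_wt [] g = run_wt K g.
Proof.
  induction g as [|[w b] g IH]; [cbn [cand_wt run_wt]; rewrite field_wt_nil; ring|].
  cbn [cand_wt run_wt]. rewrite field_wt_coin, <- IH. ring.
Qed.

Lemma cand_field_step K g g' : kernel K ->
  sumS ticks (fun t => cand_wt K (t :: g') * field_wt g (t :: g'))
  = cand_wt K g' * field_wt g g'.
Proof.
  intros [_ HK]. rewrite sumS_ticks.
  rewrite (sumS_ext l _ (fun w => (cand_wt K g' * field_wt g g') * K (hd_error (succs g')) w)).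
  - rewrite sumS_scal, HK. ring.
  - intros w _. cbn [cand_wt]. rewrite <- (field_wt_step g g' w). ring.
Qed.

Lemma cand_field_sum K g N : kernel K ->
  sumS (words ticks N) (fun g' => cand_wt K g' * field_wt g g') = field_wt g [].
Proof.
  intro HK. induction N as [|N IH]; [cbn; ring|].
  rewrite sumS_words_S, <- IH. apply sumS_ext; intros g' _. now apply cand_field_step.
Qed.

(** Given the field, the runs propose independently; they interact only through the last factor.
    Both advance by one tick at a time, whatever their numbers of successes. *)
Definition joint_wt K K' (s : list (tick * tick)) : R :=
  cand_wt K (map fst s) * cand_wt K' (map snd s) * field_wt (map fst s) (map snd s).

Lemma joint_wt_nonneg K K' s : kernel K -> kernel K' -> 0 <= joint_wt K K' s.
Proof.
  intros HK HK'. apply Rmult_le_pos; [|apply field_wt_nonneg].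
  apply Rmult_le_pos; now apply cand_wt_nonneg.
Qed.

Lemma joint_wt_nil K K' : joint_wt K K' [] = 1.
Proof. unfold joint_wt. cbn [map cand_wt]. rewrite field_wt_nil. ring. Qed.

(** The consistency needed by [letter_process]: the new tick of the second run is summed out first,
    then that of the first run, with the symmetry of [field_wt] exchanging their roles. *)
Lemma joint_wt_cons K K' s : kernel K -> kernel K' ->
  sumS (list_prod ticks ticks) (fun t => joint_wt K K' (t :: s)) = joint_wt K K' s.
Proof.
  intros HK HK'. rewrite sumS_list_prod. unfold joint_wt. cbn [map fst snd].
  set (g := map fst s). set (g' := map snd s).
  rewrite (sumS_ext ticks _ (fun t => cand_wt K' g' * (cand_wt K (t :: g) * field_wt g' (t :: g)))).
  - rewrite sumS_scal, cand_field_step, field_wt_sym by assumption. ring.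
  - intros t _.
    rewrite (sumS_ext ticks _ (fun t' => cand_wt K (t :: g) *
              (cand_wt K' (t' :: g') * field_wt (t :: g) (t' :: g')))) by (intros; ring).
    rewrite sumS_scal, cand_field_step, field_wt_sym by assumption. ring.
Qed.

(** Summing out the other run leaves the weight of the field against an empty history, and a run
    alone reads only fresh cells: its law does not feel the other kernel. *)
Lemma joint_marginal_fst K K' N phi : kernel K -> kernel K' ->
  sumS (words (list_prod ticks ticks) N) (fun s => joint_wt K K' s * phi (map fst s))
  = sumS (words ticks N) (fun g => run_wt K g * phi g).
Proof.
  intros HK HK'. unfold joint_wt.
  rewrite (sumS_words_prod ticks ticks N
    (fun g g' => cand_wt K g * cand_wt K' g' * field_wt g g' * phi g)).
  apply sumS_ext; intros g _.
  rewrite (sumS_ext _ _ (fun g' => (cand_wt K g * phi g) * (cand_wt K' g' * field_wt g g')))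
    by (intros; ring).
  rewrite sumS_scal, cand_field_sum, field_wt_sym, <- run_wtE by assumption. ring.
Qed.

Lemma joint_marginal_snd K K' N phi : kernel K -> kernel K' ->
  sumS (words (list_prod ticks ticks) N) (fun s => joint_wt K K' s * phi (map snd s))
  = sumS (words ticks N) (fun g => run_wt K' g * phi g).
Proof.
  intros HK HK'. unfold joint_wt.
  rewrite (sumS_words_prod ticks ticks N
    (fun g g' => cand_wt K g * cand_wt K' g' * field_wt g g' * phi g')).
  rewrite sumS_swap. apply sumS_ext; intros g _.
  rewrite (sumS_ext _ _ (fun g' => (cand_wt K' g * phi g) * (cand_wt K g' * field_wt g g')))
    by (intros g' _; rewrite (field_wt_sym g g'); ring).
  rewrite sumS_scal, cand_field_sum, field_wt_sym, <- run_wtE by assumption. ring.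
Qed.

Section Run.
Context (K : option St -> St -> R).
Hypothesis HK : kernel K.

Definition run_mean (N : nat) (phi : list tick -> R) : R :=
  sumS (words ticks N) (fun g => run_wt K g * phi g).

Lemma run_mean_le N phi psi :
  (forall g, phi g <= psi g) -> run_mean N phi <= run_mean N psi.
Proof.
  intro H. apply sumS_le; intros g _.
  apply Rmult_le_compat_l; [now apply run_wt_nonneg|apply H].
Qed.

Lemma run_mean_step (M M' : list tick -> R) N :
  (forall g, sumS l (fun w => K (hd_error (succs g)) w *
       (d * M ((w, true) :: g) + (1 - d) * M ((w, false) :: g))) = M' g) ->
  run_mean (S N) M = run_mean N M'.
Proof.
  intro H. unfold run_mean. rewrite sumS_words_S. apply sumS_ext; intros g _.
  rewrite <- H, <- sumS_scal, sumS_ticks. apply sumS_ext; intros w _.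
  cbn [run_wt coin]. ring.
Qed.

Lemma run_mean_martingale (M : list tick -> R) N :
  (forall g, sumS l (fun w => K (hd_error (succs g)) w *
       (d * M ((w, true) :: g) + (1 - d) * M ((w, false) :: g))) = M g) ->
  run_mean N M = M [].
Proof.
  intro H. induction N as [|N IH]; [unfold run_mean; cbn; ring|].
  rewrite <- IH. now apply run_mean_step.
Qed.

Lemma run_mean_scal N c phi : run_mean N (fun g => c * phi g) = c * run_mean N phi.
Proof. unfold run_mean. rewrite <- sumS_scal. apply sumS_ext; intros; ring. Qed.

(** Chernoff bound with the weight (1/2)^(number of successes): each tick multiplies its mean by d/2
    + (1 - d). *)
Lemma few_succs N m :
  run_mean N (fun g => ind (length (succs g) < m)%nat) <= 2 ^ m * (1 - d / 2) ^ N.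
Proof.
  set (M := fun g => (/ 2) ^ length (succs g)).
  assert (E : run_mean N M = (1 - d / 2) ^ N).
  { induction N as [|N IH]; [unfold run_mean, M; cbn; ring|].
    cbn [pow]. rewrite <- IH, <- run_mean_scal. apply run_mean_step.
    intro g. rewrite (sumS_ext l _ (fun w => ((1 - d / 2) * M g) * K (hd_error (succs g)) w)).
    - rewrite sumS_scal, (proj2 HK). ring.
    - intros w _. unfold M; cbn [succs length pow]. field. }
  rewrite <- E, <- run_mean_scal. apply run_mean_le. intro g. unfold M.
  destruct (classic (length (succs g) < m)%nat) as [H|H].
  - rewrite ind_true by assumption.
    replace m with ((m - length (succs g)) + length (succs g))%nat by lia.
    rewrite pow_add, Rmult_assoc, <- Rpow_mult_distr, Rinv_r, pow1, Rmult_1_r by lra.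
    apply pow_R1_Rle. lra.
  - rewrite ind_false by assumption. apply Rmult_le_pos; apply pow_le; lra.
Qed.

Lemma few_succs_vanish m e : 0 < e ->
  exists N, run_mean N (fun g => ind (length (succs g) < m)%nat) < e.
Proof.
  intro He. assert (H2 : 0 < 2 ^ m) by (apply pow_lt; lra).
  destruct (pow_lt_1_zero (1 - d / 2)) with (y := e / 2 ^ m) as [N HN].
  - rewrite Rabs_pos_eq; lra.
  - now apply Rdiv_lt_0_compat.
  - exists N. eapply Rle_lt_trans; [apply few_succs|].
    specialize (HN N (le_n N)). rewrite Rabs_pos_eq in HN by (apply pow_le; lra).
    apply (Rmult_lt_compat_l (2 ^ m)) in HN; [|assumption].
    replace (2 ^ m * (e / 2 ^ m)) with e in HN by (field; lra). exact HN.
Qed.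
End Run.
End Ticks.

(** * The law of the successive states of a run *)

Section Visits.
Context {St : Type} (dec : forall x y : St, {x = y} + {x <> y}) (l : list St) (d : R).
Hypothesis Hl : finite_enum l.
Hypothesis Hd : 0 < d < 1.
Context {Omega : Type} (F : (Omega -> Prop) -> Prop) (Q : (Omega -> Prop) -> R).
Hypothesis HP : prob_space F Q.
Context (K : option St -> St -> R).
Hypothesis HK : kernel l K.
Context (run : nat -> Omega -> list (St * bool)) (x0 : St).
Hypothesis run_S : forall N w, exists t, run (S N) w = t :: run N w.
Hypothesis run_F : forall N phi, F (fun w => phi (run N w)).
Hypothesis run_Q : forall N phi,
  Q (fun w => phi (run N w)) = run_mean l d K N (fun g => ind (phi g)).

(** The success of index i, counted from 0. Any N with enough successes gives the same state, by
    [visit_eq]; the default [x0] is used where the run never gets that far. *)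
Definition visit (i : nat) (w : Omega) : St :=
  match excluded_middle_informative (exists N, (i < length (succs (run N w)))%nat) with
  | left H => nth i (rev (succs (run
               (proj1_sig (constructive_indefinite_description _ H)) w))) x0
  | right _ => x0
  end.

Lemma succs_app_run N M w : (N <= M)%nat ->
  exists y, rev (succs (run M w)) = rev (succs (run N w)) ++ y.
Proof.
  induction 1 as [|M _ [y IH]]; [exists []; now rewrite app_nil_r|].
  destruct (run_S M w) as [[x b] E]. rewrite E. cbn [succs]. destruct b.
  - exists (y ++ [x]). cbn [rev]. now rewrite IH, app_assoc.
  - now exists y.
Qed.

Lemma visit_eq N i w : (i < length (succs (run N w)))%nat ->
  visit i w = nth i (rev (succs (run N w))) x0.
Proof.
  intro H. unfold visit. destruct excluded_middle_informative as [H'|H'].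
  2:{ exfalso; apply H'; now exists N. }
  destruct constructive_indefinite_description as [M HM]; cbn [proj1_sig].
  rewrite <- length_rev in H, HM.
  destruct (Nat.le_ge_cases N M) as [C|C]; destruct (succs_app_run _ _ w C) as [y E];
    rewrite E; [|symmetry]; now apply app_nth1.
Qed.

Lemma visit_F i x : F (fun w => visit i w = x).
Proof.
  rewrite (event_ext _ (fun w =>
    (exists N, (i < length (succs (run N w)))%nat /\ nth i (rev (succs (run N w))) x0 = x)
    \/ (~ (exists N, (i < length (succs (run N w)))%nat) /\ x0 = x))).
  - apply (F_or F Q HP).
    + apply (F_ex F Q HP (fun N w => (i < length (succs (run N w)))%nat
               /\ nth i (rev (succs (run N w))) x0 = x)).
      intro N. apply (run_F N (fun g => (i < length (succs g))%nat /\ nth i (rev (succs g)) x0 = x)).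
    + apply (F_and F Q HP); [|apply (F_const F Q HP)].
      apply (F_not F Q HP), (F_ex F Q HP (fun N w => (i < length (succs (run N w)))%nat)).
      intro N. apply (run_F N (fun g => (i < length (succs g))%nat)).
  - intro w. split.
    + intro H. destruct (classic (exists N, (i < length (succs (run N w)))%nat)) as [[N HN]|HN].
      * left; exists N. split; [exact HN|]. now rewrite <- visit_eq.
      * right; split; [exact HN|]. unfold visit in H.
        now destruct excluded_middle_informative.
    + intros [[N [HN H]]|[HN H]].
      * now rewrite (visit_eq N).
      * unfold visit. now destruct excluded_middle_informative.
Qed.

Section Law.
Context (m : nat) (xs : nat -> St).

Definition step_wt (i : nat) : R :=
  match i with O => K None (xs O) | S j => K (Some (xs j)) (xs i) end.

Definition matches (g : list (St * bool)) : Prop :=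
  forall i, (i <= m)%nat -> (i < length (succs g))%nat -> nth i (rev (succs g)) x0 = xs i.

(** Probability of the transitions still to come after j visits; the product is empty, hence 1, once
    j > m. *)
Definition rest_wt (j : nat) : R := prodS (seq j (S m - j)) step_wt.

(* Conditional probability, given the history [g], that the visits follow [xs]. *)
Definition law_martingale (g : list (St * bool)) : R :=
  ind (matches g) * rest_wt (length (succs g)).

Lemma kernel_le1 o w : K o w <= 1.
Proof.
  destruct HK as [HK0 HK1]. rewrite <- (HK1 o).
  apply (sumS_ge_term l (K o)); [auto|apply Hl].
Qed.

Lemma rest_wt_bounds j : 0 <= rest_wt j <= 1.
Proof.
  unfold rest_wt. induction (seq j (S m - j)) as [|i s IH]; [cbn; lra|].
  rewrite prodS_cons.
  assert (0 <= step_wt i <= 1).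
  { destruct i; cbn [step_wt]; split; apply HK || apply kernel_le1. }
  split; [apply Rmult_le_pos; tauto|]. rewrite <- (Rmult_1_r 1).
  apply Rmult_le_compat; tauto.
Qed.

(** A failure changes nothing. At a success only the proposal of the prescribed state [xs j]
    survives, and its probability is the factor that leaves [rest_wt]; beyond index m every proposal
    is accepted. *)
Lemma law_martingale_step g :
  sumS l (fun w => K (hd_error (succs g)) w *
    (d * law_martingale ((w, true) :: g) + (1 - d) * law_martingale ((w, false) :: g)))
  = law_martingale g.
Proof.
  set (j := length (succs g)).
  assert (Hrev : length (rev (succs g)) = j) by apply length_rev.
  assert (E : sumS l (fun w => K (hd_error (succs g)) w * law_martingale ((w, true) :: g))
              = law_martingale g).
  { unfold law_martingale. cbn [succs length]. fold j.
    destruct (le_lt_dec j m) as [Hj|Hj].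
    - assert (Hm : forall w, matches ((w, true) :: g) <-> matches g /\ w = xs j).
      { intro w. unfold matches. cbn [succs rev]. cbn [length]. fold j. split.
        - intro H. split.
          + intros i Hi1 Hi2. rewrite <- H by lia. symmetry. apply app_nth1. lia.
          + rewrite <- (H j) by lia. rewrite app_nth2 by lia.
            now rewrite Hrev, Nat.sub_diag.
        - intros [H ->] i Hi1 Hi2. destruct (Nat.eq_dec i j) as [->|n].
          + rewrite app_nth2 by lia. now rewrite Hrev, Nat.sub_diag.
          + rewrite app_nth1 by lia. apply H; lia. }
      rewrite (sumS_single l _ (xs j)); try apply Hl.
      + assert (Er : rest_wt j = step_wt j * rest_wt (S j)).
        { unfold rest_wt. replace (S m - j)%nat with (S (S m - S j)) by lia. reflexivity. }
        destruct (classic (matches g)) as [H|H].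
        * rewrite !ind_true by (try apply Hm; tauto). rewrite Er.
          replace (K (hd_error (succs g)) (xs j)) with (step_wt j); [ring|].
          unfold j in *. destruct (succs g) as [|x t] eqn:Eg; cbn [hd_error length] in *; [reflexivity|].
          cbn [step_wt]. f_equal. f_equal. symmetry.
          rewrite <- (H (length t)) by (rewrite ?Eg; cbn [length]; lia).
          rewrite Eg. cbn [rev]. rewrite app_nth2 by (rewrite length_rev; lia).
          rewrite length_rev, Nat.sub_diag. reflexivity.
        * rewrite !ind_false; [ring|exact H|]. rewrite Hm. tauto.
      + intros y _ Hy. rewrite ind_false; [ring|]. rewrite Hm. tauto.
    - assert (Hm : forall w, matches ((w, true) :: g) <-> matches g).
      { intro w. unfold matches. cbn [succs rev]. cbn [length]. fold j.
        split; intros H i Hi1 Hi2.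
        - rewrite <- H by lia. symmetry. apply app_nth1. lia.
        - rewrite app_nth1 by lia. apply H; lia. }
      assert (Er : forall i, (m < i)%nat -> rest_wt i = 1).
      { intros i Hi. unfold rest_wt. now replace (S m - i)%nat with O by lia. }
      rewrite (sumS_ext l _ (fun w => ind (matches g) * K (hd_error (succs g)) w)).
      + rewrite sumS_scal, (proj2 HK), Er by assumption. reflexivity.
      + intros w _. rewrite Er by lia.
        replace (matches ((w, true) :: g)) with (matches g); [ring|].
        apply propositional_extensionality. symmetry. apply Hm. }
  rewrite (sumS_ext l _ (fun w => d * (K (hd_error (succs g)) w * law_martingale ((w, true) :: g))
             + ((1 - d) * law_martingale g) * K (hd_error (succs g)) w)).
  - rewrite sumS_plus, !sumS_scal, E, (proj2 HK). ring.
  - intros w _. change (law_martingale ((w, false) :: g)) with (law_martingale g). ring.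
Qed.

(** After N ticks the event is decided unless the run has too few successes, which has a small
    probability u. Both the probability of the event and the initial value of the martingale lie
    between r and r + u, where r is the probability of having completed the prescribed path. *)
Lemma visit_law :
  Q (fun w => forall i, (i <= m)%nat -> visit i w = xs i)
  = K None (xs O) * prodn (fun i => K (Some (xs i)) (xs (S i))) m.
Proof.
  assert (E0 : law_martingale [] = K None (xs O) * prodn (fun i => K (Some (xs i)) (xs (S i))) m).
  { unfold law_martingale. rewrite ind_true by (intros i _ Hi; cbn in Hi; lia).
    rewrite Rmult_1_l. unfold rest_wt. cbn [succs length]. rewrite Nat.sub_0_r.
    induction m as [|k IH]; [cbn; ring|].
    rewrite seq_S. cbn [prodn]. rewrite <- Rmult_assoc, <- IH.
    assert (Ep : forall s f (x : nat), prodS (s ++ [x]) f = prodS s f * f x).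
    { induction s as [|y s IHs]; intros f x; [cbn; ring|].
      cbn [app]. rewrite !prodS_cons, IHs. ring. }
    rewrite Ep. reflexivity. }
  rewrite <- E0.
  set (E := fun w => forall i, (i <= m)%nat -> visit i w = xs i).
  assert (HFE : F E).
  { apply (F_all F Q HP (fun i w => (i <= m)%nat -> visit i w = xs i)). intro i.
    apply (F_imp F Q HP); [apply (F_const F Q HP)|apply visit_F]. }
  apply cond_eq. intros e He.
  destruct (few_succs_vanish l d Hd K HK (S m) e He) as [N HN].
  eapply Rle_lt_trans; [|exact HN].
  set (u := run_mean l d K N (fun g => ind (length (succs g) < S m)%nat)) in *.
  set (D := fun g : list (St * bool) => (m < length (succs g))%nat /\ matches g).
  set (r := run_mean l d K N (fun g => ind (D g))).
  assert (H1 : r <= Q E).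
  { unfold r. rewrite <- run_Q. apply (Q_le F Q HP); [apply run_F|exact HFE|].
    intros w [H H'] i Hi. rewrite (visit_eq N) by lia. apply H'; lia. }
  assert (H2 : Q E <= r + u).
  { unfold r, u. rewrite <- (run_Q N D), <- (run_Q N (fun g => (length (succs g) < S m)%nat)).
    eapply Rle_trans; [|apply (Q_or_le F Q HP)].
    - apply (Q_le F Q HP); [exact HFE| |].
      + apply (F_or F Q HP); [apply run_F|apply (run_F N (fun g => (length (succs g) < S m)%nat))].
      + intros w Hw. destruct (le_lt_dec (S m) (length (succs (run N w)))) as [H|H].
        * left. split; [lia|]. intros i Hi1 Hi2. rewrite <- visit_eq by assumption. now apply Hw.
        * now right.
    - apply run_F.
    - apply (run_F N (fun g => (length (succs g) < S m)%nat)). }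
  assert (H3 : r <= law_martingale []).
  { rewrite <- (run_mean_martingale l d K law_martingale N law_martingale_step).
    apply (run_mean_le l d Hd K HK). intro g. unfold law_martingale.
    destruct (classic (D g)) as [H|H].
    - rewrite !ind_true by apply H. unfold rest_wt.
      replace (S m - length (succs g))%nat with O by (destruct H; lia). cbn; lra.
    - rewrite (ind_false (D g)) by exact H.
      apply Rmult_le_pos; [apply ind_bounds|apply rest_wt_bounds]. }
  assert (H4 : law_martingale [] <= r + u).
  { rewrite <- (run_mean_martingale l d K law_martingale N law_martingale_step).
    unfold r, u, run_mean. rewrite <- sumS_plus. apply sumS_le; intros g _.
    rewrite <- Rmult_plus_distr_l. apply Rmult_le_compat_l.
    { exact (run_wt_nonneg l d Hd K g HK). }
    unfold law_martingale.
    pose proof (ind_bounds (D g)). pose proof (ind_bounds (matches g)).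
    pose proof (rest_wt_bounds (length (succs g))).
    destruct (le_lt_dec (S m) (length (succs g))) as [H'|H'].
    - pose proof (ind_bounds (length (succs g) < S m)%nat).
      assert (ind (matches g) <= ind (D g)); [|nra].
      apply ind_le. unfold D. intro; split; [lia|assumption].
    - rewrite (ind_true (length (succs g) < S m)%nat) by assumption. nra. }
  apply Rabs_le. lra.
Qed.
End Law.
End Visits.

(** * Failure counts: comparison of two runs, and exponential moments *)

Section Failures.
Context {St : Type} (dec : forall x y : St, {x = y} + {x <> y}) (l : list St) (d : R).
Hypothesis Hl : finite_enum l.
Hypothesis Hd : 0 < d < 1.

(* Number of unsuccessful proposals of [z] before the [m]-th success. *)
Fixpoint fails (z : St) (m : nat) (g : list (St * bool)) : nat :=
  match g with
  | [] => O
  | (w, b) :: g' =>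
      if b then fails z m g'
      else if dec w z then
             if lt_dec (length (succs g')) m then S (fails z m g') else fails z m g'
           else fails z m g'
  end.

Lemma repeat_snoc {A} (a : A) k : repeat a k ++ [a] = a :: repeat a k.
Proof. induction k as [|k IH]; [reflexivity|]. cbn. now rewrite IH. Qed.

Lemma rev_repeat {A} (a : A) k : rev (repeat a k) = repeat a k.
Proof. induction k as [|k IH]; [reflexivity|]. cbn. now rewrite IH, repeat_snoc. Qed.

Lemma reads_before_success z m g :
  ~ In z (succs g) -> (length (succs g) < m)%nat ->
  reads dec z g = repeat false (fails z m g).
Proof.
  induction g as [|[w b] g IH]; intros Hz Hm; [reflexivity|].
  destruct b; cbn [succs reads fails length] in *.
  - destruct (dec w z) as [->|]; [exfalso; apply Hz; now left|].
    apply IH; [|lia]. intro H; apply Hz; now right.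
  - rewrite IH by assumption.
    destruct (dec w z); [|reflexivity]. destruct lt_dec; [reflexivity|lia].
Qed.

(** A success in column z would be a visit to z, so all its cells read before the m-th success are
    failures; [r] collects the later readings, of any kind. *)
Lemma reads_of_unvisited z m g : ~ In z (firstn m (rev (succs g))) ->
  exists r, rev (reads dec z g) = repeat false (fails z m g) ++ r.
Proof.
  induction g as [|[w b] g IH]; intro Hz; [now exists []|].
  destruct (lt_dec (length (succs g)) m) as [H|H].
  - exists []. rewrite app_nil_r, <- rev_repeat. f_equal.
    rewrite firstn_all2, <- in_rev in Hz.
    2:{ rewrite length_rev. destruct b; cbn [succs length]; lia. }
    destruct b; [|now apply reads_before_success].
    cbn [succs reads fails] in *.
    destruct (dec w z) as [->|]; [exfalso; apply Hz; now left|].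
    apply reads_before_success; [|lia]. intro Hin; apply Hz; now right.
  - assert (Hz' : ~ In z (firstn m (rev (succs g)))).
    { intro Hin; apply Hz. destruct b; cbn [succs]; [|exact Hin].
      cbn [rev]. rewrite firstn_app. apply in_or_app. now left. }
    destruct (IH Hz') as [r Hr].
    assert (E : fails z m ((w, b) :: g) = fails z m g).
    { cbn [fails]. destruct b; [reflexivity|]. destruct (dec w z); [|reflexivity].
      now destruct lt_dec. }
    rewrite E. cbn [reads]. destruct (dec w z); [|now exists r].
    cbn [rev]. rewrite Hr, <- app_assoc. now exists (r ++ [b]).
Qed.

(** Here h is the number of failures before the first success in column z; that success is among the
    first k, so these failures are all counted by [fails]. *)
Lemma reads_of_visited z k g : In z (firstn k (rev (succs g))) ->
  exists h r, rev (reads dec z g) = repeat false h ++ true :: r /\ (h <= fails z k g)%nat.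
Proof.
  induction g as [|[w b] g IH]; intro Hz; [now rewrite firstn_nil in Hz|].
  assert (E : (fails z k g <= fails z k ((w, b) :: g))%nat).
  { cbn [fails]. destruct b; [lia|]. destruct (dec w z); [|lia]. destruct lt_dec; lia. }
  destruct (classic (In z (firstn k (rev (succs g))))) as [Hz'|Hz'].
  - destruct (IH Hz') as [h [r [Hr Hh]]]. exists h.
    cbn [reads]. destruct (dec w z); [|exists r; split; [exact Hr|lia]].
    exists (r ++ [b]). split; [|lia]. cbn [rev]. rewrite Hr, <- app_assoc. reflexivity.
  - destruct b; [|easy]. cbn [succs rev] in Hz. rewrite firstn_app in Hz.
    apply in_app_or in Hz as [Hz|Hz]; [easy|].
    destruct (le_lt_dec k (length (succs g))) as [C|C].
    { rewrite length_rev in Hz. replace (k - length (succs g))%nat with O in Hz by lia. easy. }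
    assert (w = z) as ->.
    { destruct (k - length (rev (succs g)))%nat; [easy|].
      cbn in Hz. rewrite firstn_nil in Hz. now destruct Hz as [Hz|[]]. }
    rewrite firstn_all2, <- in_rev in Hz' by (rewrite length_rev; lia).
    exists (fails z k g), []. cbn [reads]. destruct (dec z z); [|easy].
    cbn [rev]. rewrite (reads_before_success z k g) by assumption.
    now rewrite rev_repeat.
Qed.

(** The first success that g' finds in column z bounds the run of failures that g can have met
    there, since both read the same cells. A nonzero [field_wt] is what makes the two histories
    compatible. *)
Lemma fails_le_of_missed z m k g g' : field_wt dec l d g g' <> 0 ->
  ~ In z (firstn m (rev (succs g))) -> In z (firstn k (rev (succs g'))) ->
  (fails z m g <= fails z k g')%nat.
Proof.
  intros Hf Hm Hk.
  destruct (reads_of_unvisited z m g Hm) as [r Er].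
  destruct (reads_of_visited z k g' Hk) as [h [r' [Er' Hh]]].
  assert (Ha := prodS_neq0 l _ z (proj2 Hl z) Hf). cbn beta in Ha. rewrite Er, Er' in Ha.
  apply agree_first_true in Ha. lia.
Qed.

Section Mgf.
Context (K : option St -> St -> R).
Hypothesis HK : kernel l K.
Context (z : St) (theta eta : R).
Hypothesis theta_nz : theta <> 0.
Hypothesis eta_def : (1 - d) * eta = d * theta.
Hypothesis eta_gt : -1 < eta.
Hypothesis theta_lt : forall o, theta * K o z < 1.

(** While the state is o, the failures until the next success contribute a geometric series, d / (1
    - (1 - d)(1 + eta K(o,z))), which is 1 / (1 - theta K(o,z)) by [eta_def]. The accepted proposal
    is independent of them and has law [K o]. *)
Fixpoint mgf (m : nat) (o : option St) : R :=
  match m with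
  | O => 1
  | S m' => / (1 - theta * K o z) * sumS l (fun w => K o w * mgf m' (Some w))
  end.

Lemma mgf_nonneg m o : 0 <= mgf m o.
Proof.
  revert o; induction m as [|m IH]; intro o; cbn [mgf]; [lra|].
  apply Rmult_le_pos.
  - left. apply Rinv_0_lt_compat. pose proof (theta_lt o). lra.
  - apply sumS_nonneg; intros w _. apply Rmult_le_pos; [apply HK|apply IH].
Qed.

Definition fails_martingale (m : nat) (g : list (St * bool)) : R :=
  (1 + eta) ^ fails z m g * mgf (m - length (succs g)) (hd_error (succs g)).

Lemma fails_martingale_step m g :
  sumS l (fun w => K (hd_error (succs g)) w *
    (d * fails_martingale m ((w, true) :: g) + (1 - d) * fails_martingale m ((w, false) :: g)))
  = fails_martingale m g.
Proof.
  unfold fails_martingale. cbn [succs fails hd_error length].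
  set (o := hd_error (succs g)). set (e := (1 + eta) ^ fails z m g).
  destruct (lt_dec (length (succs g)) m) as [H|H].
  - replace (m - length (succs g))%nat with (S (m - S (length (succs g)))) by lia.
    set (j := (m - S (length (succs g)))%nat).
    set (G := mgf (S j) o).
    rewrite (sumS_ext l _ (fun w => (d * e) * (K o w * mgf j (Some w))
               + (((1 - d) * e * G) * K o w
                  + ((1 - d) * e * G * eta) * (if dec w z then K o w else 0)))).
    + rewrite !sumS_plus, !sumS_scal, (proj2 HK).
      rewrite (sumS_single l (fun w => if dec w z then K o w else 0) z); try apply Hl.
      2:{ intros y _ Hy. now destruct (dec y z). }
      destruct (dec z z); [|easy].
      assert (EG : sumS l (fun w => K o w * mgf j (Some w)) = (1 - theta * K o z) * G).
      { unfold G. cbn [mgf]. pose proof (theta_lt o). field. lra. }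
      rewrite EG.
      (* The extra weight of a failed proposal of z must cancel the deficit theta K(o,z) left by the
         success term; [eta_def] is exactly this balance. *)
      replace ((1 - d) * e * G * eta * K o z) with (((1 - d) * eta) * (e * G * K o z)) by ring.
      rewrite eta_def. ring.
    + intros w _. fold G. destruct (dec w z); cbn [pow]; fold e; ring.
  - replace (m - length (succs g))%nat with O by lia.
    replace (m - S (length (succs g)))%nat with O by lia. cbn [mgf].
    rewrite (sumS_ext l _ (fun w => e * K o w)).
    + rewrite sumS_scal, (proj2 HK). ring.
    + intros w _. destruct (dec w z); fold e; ring.
Qed.

(** Exponential Markov inequality. Once m successes have occurred, [fails] is final and the [mgf]
    factor of the martingale is 1, so no stopping time is needed. The sign of theta, shared by ln(1
    + eta), selects the upper or the lower tail. *)
Lemma fails_tail N m a :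
  run_mean l d K N (fun g => ind ((m <= length (succs g))%nat /\ 0 <= theta * (INR (fails z m g) - a)))
  <= exp (- ln (1 + eta) * a) * mgf m None.
Proof.
  replace (mgf m None) with (fails_martingale m [])
    by (unfold fails_martingale; cbn [fails succs length hd_error pow];
        rewrite Nat.sub_0_r; ring).
  rewrite <- (run_mean_martingale l d K (fails_martingale m) N (fails_martingale_step m)).
  rewrite <- run_mean_scal. apply (run_mean_le l d Hd K HK). intro g.
  unfold fails_martingale.
  set (f := fails z m g).
  assert (E : (1 + eta) ^ f = exp (ln (1 + eta) * INR f)).
  { rewrite Rmult_comm. rewrite <- (Rpower_pow f (1 + eta)) by lra. reflexivity. }
  rewrite E, <- Rmult_assoc, <- exp_plus.
  set (lam := ln (1 + eta)) in *.
  destruct (classic ((m <= length (succs g))%nat /\ 0 <= theta * (INR f - a))) as [H|H].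
  - rewrite ind_true by exact H. destruct H as [H1 H2].
    replace (m - length (succs g))%nat with O by lia. cbn [mgf]. rewrite Rmult_1_r.
    apply Rle_trans with (1 + (- lam * a + lam * INR f)); [|apply exp_ineq1_le].
    assert (0 <= lam * (INR f - a)); [|lra].
    destruct (Rdichotomy _ _ theta_nz) as [Ht|Ht].
    + assert (INR f - a <= 0) by nra. assert (eta < 0) by nra.
      assert (lam < 0); [|nra]. unfold lam. rewrite <- ln_1. apply ln_increasing; lra.
    + assert (0 <= INR f - a) by nra. assert (0 < eta) by nra.
      assert (0 < lam); [|nra]. unfold lam. rewrite <- ln_1. apply ln_increasing; lra.
  - rewrite ind_false by exact H.
    apply Rmult_le_pos; [left; apply exp_pos|apply mgf_nonneg].
Qed.
End Mgf.
End Failures.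

Lemma In_firstn_nth {A} (x d : A) k l : In x (firstn k l) ->
  exists i, (i < k)%nat /\ (i < length l)%nat /\ nth i l d = x.
Proof.
  intro H. destruct (In_nth _ _ d H) as [i [Hi E]].
  rewrite length_firstn in Hi. exists i. repeat split; try lia.
  rewrite <- E, nth_firstn. destruct (Nat.ltb_spec i k); [reflexivity|lia].
Qed.

Lemma nth_In_firstn {A} (d : A) i k l :
  (i < k)%nat -> (i < length l)%nat -> In (nth i l d) (firstn k l).
Proof.
  intros H1 H2.
  replace (nth i l d) with (nth i (firstn k l) d).
  - apply nth_In. rewrite length_firstn. lia.
  - rewrite nth_firstn. destruct (Nat.ltb_spec i k); [reflexivity|lia].
Qed.

Definition missed {Omega St : Type} (V V' : nat -> Omega -> St) (m k : nat) (w : Omega) : Prop :=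
  exists i, (i < k)%nat /\ forall j, (j < m)%nat -> V j w <> V' i w.

(** * The coupling and the probability of a missed state *)

Section Coupling.
Context {St : Type} (dec : forall x y : St, {x = y} + {x <> y}) (l : list St) (d : R) (x0 : St).
Hypothesis Hl : finite_enum l.
Hypothesis Hd : 0 < d < 1.

(** The condition on the number of successes ensures that the failure count has reached its final
    value. *)
Definition few_fails (z : St) (m : nat) (a : R) (g : list (St * bool)) : Prop :=
  (m <= length (succs g))%nat /\ INR (fails dec z m g) <= a.
Definition many_fails (z : St) (m : nat) (a : R) (g : list (St * bool)) : Prop :=
  (m <= length (succs g))%nat /\ a <= INR (fails dec z m g).

Section Missed.
Context {Omega T : Type} (F : (Omega -> Prop) -> Prop) (Q : (Omega -> Prop) -> R).
Hypothesis HP : prob_space F Q.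
Context (lT : list T) (pre : nat -> Omega -> list T) (q : list T -> R)
  (p1 p2 : list T -> list (St * bool)) (K1 K2 : option St -> St -> R).
Hypothesis HK1 : kernel l K1.
Hypothesis HK2 : kernel l K2.
Hypothesis q_nonneg : forall s, 0 <= q s.
Hypothesis q_field : forall s, q s <> 0 -> field_wt dec l d (p1 s) (p2 s) <> 0.
Hypothesis run1_S : forall N w, exists t, p1 (pre (S N) w) = t :: p1 (pre N w).
Hypothesis run2_S : forall N w, exists t, p2 (pre (S N) w) = t :: p2 (pre N w).
Hypothesis pre_F : forall N (phi : list T -> Prop), F (fun w => phi (pre N w)).
Hypothesis pre_Q : forall N (phi : list T -> Prop),
  Q (fun w => phi (pre N w)) = sumS (words lT N) (fun s => q s * ind (phi s)).
Hypothesis marginal1 : forall N phi,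
  sumS (words lT N) (fun s => q s * phi (p1 s)) = run_mean l d K1 N phi.
Hypothesis marginal2 : forall N phi,
  sumS (words lT N) (fun s => q s * phi (p2 s)) = run_mean l d K2 N phi.

Local Notation V1 := (visit (fun N w => p1 (pre N w)) x0).
Local Notation V2 := (visit (fun N w => p2 (pre N w)) x0).

Lemma missed_F m k : F (missed V1 V2 m k).
Proof.
  assert (H1 := fun i x => visit_F F Q HP _ x0 run1_S (fun N phi => pre_F N (fun s => phi (p1 s))) i x).
  assert (H2 := fun i x => visit_F F Q HP _ x0 run2_S (fun N phi => pre_F N (fun s => phi (p2 s))) i x).
  unfold missed.
  apply (F_ex F Q HP (fun i w => (i < k)%nat /\ forall j, (j < m)%nat -> V1 j w <> V2 i w)).
  intro i. apply (F_and F Q HP); [apply (F_const F Q HP)|].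
  apply (F_all F Q HP (fun j w => (j < m)%nat -> V1 j w <> V2 i w)). intro j.
  apply (F_imp F Q HP); [apply (F_const F Q HP)|]. apply (F_not F Q HP).
  rewrite (event_ext _ (fun w => exists x, In x l /\ (V1 j w = x /\ V2 i w = x))).
  - apply (F_ex_list F Q HP). intro x. now apply (F_and F Q HP).
  - intro w. split; [intro E; exists (V1 j w); split; [apply Hl|now rewrite E]|].
    intros [x [_ [-> ->]]]. reflexivity.
Qed.

(** A missed z forces the count of the first run below that of the second; hence, for any level
    [a z], the former has few failures or the latter many. The projections [p1] and [p2] are
    abstract so that the runs can be exchanged. *)
Lemma missed_bound m k (a b1 b2 : St -> R) :
  (forall z N, run_mean l d K1 N (fun g => ind (few_fails z m (a z) g)) <= b1 z) ->
  (forall z N, run_mean l d K2 N (fun g => ind (many_fails z k (a z) g)) <= b2 z) ->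
  Q (missed V1 V2 m k) <= sumS l (fun z => b1 z + b2 z).
Proof.
  intros Hb1 Hb2. apply le_epsilon. intros e He.
  assert (He2 : 0 < e / 2) by lra.
  destruct (few_succs_vanish l d Hd K1 HK1 m _ He2) as [N1 HN1].
  destruct (few_succs_vanish l d Hd K2 HK2 k _ He2) as [N2 HN2].
  (* Having too few successes becomes less likely as N grows, so the larger of [N1] and [N2] serves
     both runs. *)
  assert (Hmono : forall p (K : option St -> St -> R) i N N',
    (forall N w, exists t, p (pre (S N) w) = t :: p (pre N w)) ->
    (forall N phi, sumS (words lT N) (fun s => q s * phi (p s)) = run_mean l d K N phi) ->
    (N <= N')%nat ->
    run_mean l d K N' (fun g => ind (length (succs g) < i)%nat)
    <= run_mean l d K N (fun g => ind (length (succs g) < i)%nat)).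
  { intros p K i N N' Hp Hm HN. rewrite <- !Hm.
    rewrite <- (pre_Q N (fun s => (length (succs (p s)) < i)%nat)).
    rewrite <- (pre_Q N' (fun s => (length (succs (p s)) < i)%nat)).
    apply (Q_le F Q HP).
    - apply (pre_F N' (fun s => (length (succs (p s)) < i)%nat)).
    - apply (pre_F N (fun s => (length (succs (p s)) < i)%nat)).
    - intros w Hw.
      destruct (succs_app_run (fun N w => p (pre N w)) Hp N N' w HN) as [y Ey].
      apply (f_equal (@length St)) in Ey. rewrite length_app, !length_rev in Ey. lia. }
  set (N := Nat.max N1 N2).
  assert (HN1' := Hmono p1 K1 m N1 N run1_S marginal1 (Nat.le_max_l _ _)).
  assert (HN2' := Hmono p2 K2 k N2 N run2_S marginal2 (Nat.le_max_r _ _)).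
  clear Hmono.
  set (B1 := fun s => (length (succs (p1 s)) < m)%nat).
  set (B2 := fun s => (length (succs (p2 s)) < k)%nat).
  set (A := fun s => (m <= length (succs (p1 s)))%nat /\ (k <= length (succs (p2 s)))%nat /\
     exists z, In z (firstn k (rev (succs (p2 s)))) /\ ~ In z (firstn m (rev (succs (p1 s))))).
  assert (HA : Q (fun w => A (pre N w)) <= sumS l (fun z => b1 z + b2 z)).
  { rewrite pre_Q.
    apply Rle_trans with (sumS (words lT N) (fun s => q s * sumS l (fun z =>
       ind (few_fails z m (a z) (p1 s)) + ind (many_fails z k (a z) (p2 s))))).
    - apply sumS_le; intros s _.
      assert (Hnn : forall y, In y l -> 0 <= ind (few_fails y m (a y) (p1 s))
                                        + ind (many_fails y k (a y) (p2 s))).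
      { intros y _. pose proof (ind_bounds (few_fails y m (a y) (p1 s))).
        pose proof (ind_bounds (many_fails y k (a y) (p2 s))). lra. }
      (* Incompatible pairs of histories have weight 0; the comparison of failures is needed only
         for the others. *)
      destruct (Req_dec (q s) 0) as [->|Hq]; [lra|].
      apply Rmult_le_compat_l; [apply q_nonneg|].
      destruct (classic (A s)) as [H|H]; [|rewrite ind_false by exact H; now apply sumS_nonneg].
      rewrite ind_true by exact H. destruct H as [Hm [Hk [z [Hz2 Hz1]]]].
      eapply Rle_trans; [|apply (sumS_ge_term l _ z Hnn); apply Hl].
      assert (Hle := fails_le_of_missed dec l d Hl Hd z m k _ _ (q_field s Hq) Hz1 Hz2).
      apply le_INR in Hle.
      destruct (Rle_lt_dec (INR (fails dec z m (p1 s))) (a z)) as [C|C].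
      + rewrite (ind_true (few_fails _ _ _ _)) by (split; assumption).
        pose proof (ind_bounds (many_fails z k (a z) (p2 s))). lra.
      + rewrite (ind_true (many_fails _ _ _ _)) by (split; [assumption|lra]).
        pose proof (ind_bounds (few_fails z m (a z) (p1 s))). lra.
    - rewrite (sumS_ext (words lT N) _ (fun s => sumS l (fun z =>
         q s * ind (few_fails z m (a z) (p1 s)) + q s * ind (many_fails z k (a z) (p2 s)))))
        by (intros s _; rewrite <- sumS_scal; apply sumS_ext; intros; ring).
      rewrite sumS_swap. apply sumS_le; intros z _. rewrite sumS_plus.
      rewrite (marginal1 N (fun g => ind (few_fails z m (a z) g))).
      rewrite (marginal2 N (fun g => ind (many_fails z k (a z) g))).
      now apply Rplus_le_compat. }
  assert (HB1 : Q (fun w => B1 (pre N w)) < e / 2).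
  { rewrite pre_Q. unfold B1. rewrite (marginal1 N (fun g => ind (length (succs g) < m)%nat)). lra. }
  assert (HB2 : Q (fun w => B2 (pre N w)) < e / 2).
  { rewrite pre_Q. unfold B2. rewrite (marginal2 N (fun g => ind (length (succs g) < k)%nat)). lra. }
  assert (HQ : Q (missed V1 V2 m k)
               <= Q (fun w => A (pre N w) \/ (B1 (pre N w) \/ B2 (pre N w)))).
  { apply (Q_le F Q HP); [apply missed_F| |].
    - repeat apply (F_or F Q HP); apply pre_F.
    - intros w [i [Hi Hj]].
      destruct (le_lt_dec m (length (succs (p1 (pre N w))))) as [Hm|Hm]; [|tauto].
      destruct (le_lt_dec k (length (succs (p2 (pre N w))))) as [Hk|Hk]; [|tauto].
      left. split; [exact Hm|]. split; [exact Hk|]. exists (V2 i w). split.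
      + rewrite (visit_eq (fun N w => p2 (pre N w)) x0 run2_S N) by lia.
        apply nth_In_firstn; rewrite ?length_rev; lia.
      + intro Hin. destruct (In_firstn_nth _ x0 _ _ Hin) as [j [Hjm [Hjl Ej]]].
        rewrite length_rev in Hjl. apply (Hj j Hjm).
        rewrite <- Ej. now apply (visit_eq (fun N w => p1 (pre N w)) x0 run1_S N). }
  pose proof (Q_or_le F Q HP _ _ (pre_F N A) (F_or F Q HP _ _ (pre_F N B1) (pre_F N B2))).
  pose proof (Q_or_le F Q HP _ _ (pre_F N B1) (pre_F N B2)).
  lra.
Qed.
End Missed.

(** Space and processes come before m, k and the levels, as the theorem demands one coupling for all
    n and eps. *)
Lemma soft_local_time_coupling (KZ KU : option St -> St -> R) :
  kernel l KZ -> kernel l KU ->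
  exists (Omega : Type) (F : (Omega -> Prop) -> Prop) (Q : (Omega -> Prop) -> R)
         (Z U : nat -> Omega -> St),
    prob_space F Q /\
    (measurable_seq F Z /\ forall m xs, Q (fun w => forall i, (i <= m)%nat -> Z i w = xs i)
       = KZ None (xs O) * prodn (fun i => KZ (Some (xs i)) (xs (S i))) m) /\
    (measurable_seq F U /\ forall m xs, Q (fun w => forall i, (i <= m)%nat -> U i w = xs i)
       = KU None (xs O) * prodn (fun i => KU (Some (xs i)) (xs (S i))) m) /\
    forall m k,
      (F (missed Z U m k) /\ forall a b1 b2,
        (forall z N, run_mean l d KZ N (fun g => ind (few_fails z m (a z) g)) <= b1 z) ->
        (forall z N, run_mean l d KU N (fun g => ind (many_fails z k (a z) g)) <= b2 z) ->
        Q (missed Z U m k) <= sumS l (fun z => b1 z + b2 z)) /\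
      (F (missed U Z k m) /\ forall a b1 b2,
        (forall z N, run_mean l d KU N (fun g => ind (few_fails z k (a z) g)) <= b1 z) ->
        (forall z N, run_mean l d KZ N (fun g => ind (many_fails z m (a z) g)) <= b2 z) ->
        Q (missed U Z k m) <= sumS l (fun z => b1 z + b2 z)).
Proof.
  intros HZ HU.
  set (lT := list_prod (ticks l) (ticks l)).
  set (q := joint_wt dec l d KZ KU).
  assert (Ht : finite_enum (ticks l)).
  { split.
    - apply NoDup_list_prod; [apply Hl|]. repeat constructor; cbn; intuition discriminate.
    - intros [x b]. apply in_prod; [apply Hl|]. destruct b; cbn; tauto. }
  assert (HT : finite_enum lT).
  { split; [apply NoDup_list_prod; apply Ht|]. intros [t t']. apply in_prod; apply Ht. }
  set (a0 := ((x0, true), (x0, true))).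
  destruct (letter_process lT a0 q HT) as [F [Q [HP HF]]].
  - apply joint_wt_nil.
  - intro s. now apply joint_wt_nonneg.
  - intro s. now apply joint_wt_cons.
  - set (pre := digits lT a0 q) in *.
    set (rZ := fun N w => map fst (pre N w)). set (rU := fun N w => map snd (pre N w)).
    assert (HZS : forall N w, exists t, rZ (S N) w = t :: rZ N w) by (intros; eexists; reflexivity).
    assert (HUS : forall N w, exists t, rU (S N) w = t :: rU N w) by (intros; eexists; reflexivity).
    assert (Hf : forall s, q s <> 0 -> field_wt dec l d (map fst s) (map snd s) <> 0).
    { intros s Hq E. apply Hq. unfold q, joint_wt. rewrite E. ring. }
    assert (Hq0 : forall s, 0 <= q s) by (intro s; now apply joint_wt_nonneg).
    assert (M1 := fun N phi => joint_marginal_fst dec l d Hl Hd KZ KU N phi HZ HU).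
    assert (M2 := fun N phi => joint_marginal_snd dec l d Hl Hd KZ KU N phi HZ HU).
    assert (HF1 : forall N phi, F (fun w => phi (pre N w))) by (intros; apply HF).
    assert (HQ1 : forall N phi, Q (fun w => phi (pre N w))
        = sumS (words lT N) (fun s => q s * ind (phi s))) by (intros; apply HF).
    exists R, F, Q, (visit rZ x0), (visit rU x0). split; [exact HP|].
    split; [|split].
    + split.
      * intros i x. apply (visit_F F Q HP rZ x0 HZS).
        intros N phi. apply (HF1 N (fun s => phi (map fst s))).
      * intros m xs. apply (visit_law l d Hl Hd F Q HP KZ HZ rZ x0 HZS).
        -- intros N phi. apply (HF1 N (fun s => phi (map fst s))).
        -- intros N phi. unfold rZ. rewrite (HQ1 N (fun s => phi (map fst s))). apply (M1 N (fun g => ind (phi g))).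
    + split.
      * intros i x. apply (visit_F F Q HP rU x0 HUS).
        intros N phi. apply (HF1 N (fun s => phi (map snd s))).
      * intros m xs. apply (visit_law l d Hl Hd F Q HP KU HU rU x0 HUS).
        -- intros N phi. apply (HF1 N (fun s => phi (map snd s))).
        -- intros N phi. unfold rU. rewrite (HQ1 N (fun s => phi (map snd s))). apply (M2 N (fun g => ind (phi g))).
    + intros m k. split; split.
      * now apply (missed_F F Q HP pre (map fst) (map snd)).
      * intros a b1 b2. now apply (missed_bound F Q HP lT pre q (map fst) (map snd) KZ KU).
      * now apply (missed_F F Q HP pre (map snd) (map fst)).
      * intros a b1 b2. apply (missed_bound F Q HP lT pre q (map snd) (map fst) KU KZ);
          try assumption.
        intros s Hq. rewrite field_wt_sym. now apply Hf.
Qed.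
End Coupling.

(** * Exponential moments of additive functionals *)

Lemma exp_le_mono x y : x <= y -> exp x <= exp y.
Proof. intros [H| ->]; [left; now apply exp_increasing|apply Rle_refl]. Qed.

Lemma exp_le_inv u : u < 1 -> exp u <= / (1 - u).
Proof.
  intro Hu. pose proof (exp_ineq1_le (- u)) as H.
  rewrite <- (Ropp_involutive u) at 1. rewrite exp_Ropp.
  apply Rinv_le_contravar; lra.
Qed.

Lemma exp_le_quadratic u : u <= / 2 -> exp u <= 1 + u + 2 * u ^ 2.
Proof.
  intro Hu. eapply Rle_trans; [apply exp_le_inv; lra|].
  apply (Rmult_le_reg_l (1 - u)); [lra|]. rewrite Rinv_r by lra.
  assert (0 <= u ^ 2) by apply pow2_ge_0. nra.
Qed.

Lemma inv_le_exp u : u <= / 2 -> / (1 - u) <= exp (u + 2 * u ^ 2).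
Proof.
  intro Hu. apply Rle_trans with (1 + (u + 2 * u ^ 2)); [|apply exp_ineq1_le].
  apply (Rmult_le_reg_l (1 - u)); [lra|]. rewrite Rinv_r by lra.
  assert (0 <= u ^ 2) by apply pow2_ge_0. nra.
Qed.

Lemma ln_ge_quadratic u : - / 2 <= u -> u - 2 * u ^ 2 <= ln (1 + u).
Proof.
  intro Hu. set (y := ln (1 + u)).
  assert (E : exp (- y) = / (1 + u)) by (unfold y; rewrite exp_Ropp, exp_ln; [reflexivity|lra]).
  pose proof (exp_ineq1_le (- y)) as H. rewrite E in H.
  apply Rle_trans with (1 - / (1 + u)); [|lra].
  apply (Rmult_le_reg_l (1 + u)); [lra|].
  replace ((1 + u) * (1 - / (1 + u))) with u by (field; lra).
  assert (0 <= u ^ 2) by apply pow2_ge_0. nra.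
Qed.

(** Jensen's inequality: exp lies above its tangent at s = sum of c, and the slope term vanishes on
    averaging. *)
Lemma exp_sum_le_mean {A} (J : list A) (c : A -> R) : J <> [] ->
  exp (sumS J c)
  <= / INR (length J) * sumS J (fun j => exp (INR (length J) * c j)).
Proof.
  intro HJ.
  assert (Hn : 0 < INR (length J)) by (apply lt_0_INR; destruct J; [easy|cbn; lia]).
  set (n := INR (length J)) in *. set (s := sumS J c).
  assert (Hc : sumS J (fun _ => 1) = n).
  { unfold n. clear. induction J as [|a J IH]; [reflexivity|].
    rewrite sumS_cons, IH. cbn [length]. rewrite S_INR. ring. }
  apply (Rmult_le_reg_l n); [assumption|]. rewrite <- Rmult_assoc, Rinv_r, Rmult_1_l by lra.
  apply Rle_trans with (sumS J (fun j => exp s * ((1 - s) * 1 + n * c j))).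
  - rewrite sumS_scal, sumS_plus, !sumS_scal, Hc. fold s. right; ring.
  - apply sumS_le; intros j _.
    replace (n * c j) with (s + (n * c j - s)) at 2 by ring. rewrite exp_plus.
    apply Rmult_le_compat_l; [left; apply exp_pos|].
    pose proof (exp_ineq1_le (n * c j - s)). lra.
Qed.

Section Blocks.
Context {St : Type} (dec : forall x y : St, {x = y} + {x <> y}) (l : list St)
  (P : St -> St -> R).
Hypothesis Hl : finite_enum l.
Hypothesis HP : stochastic l P.

Lemma Pn_left n x y : Pn dec l P (S n) x y = sumS l (fun z => P x z * Pn dec l P n z y).
Proof.
  revert y; induction n as [|n IH]; intro y.
  - cbn [Pn]. rewrite (sumS_single l _ x), (sumS_single l _ y); try apply Hl.
    + destruct (dec x x), (dec y y); try easy. ring.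
    + intros z _ Hz. destruct (dec z y); [easy|ring].
    + intros z _ Hz. destruct (dec x z); [now subst|ring].
  - change (Pn dec l P (S (S n)) x y) with (sumS l (fun z => Pn dec l P (S n) x z * P z y)).
    rewrite (sumS_ext l _ (fun z => sumS l (fun w => P x w * (Pn dec l P n w z * P z y)))).
    + rewrite sumS_swap. apply sumS_ext; intros w _. cbn [Pn].
      now rewrite sumS_scal.
    + intros z _. rewrite IH, <- sumS_scal_r. apply sumS_ext; intros; ring.
Qed.

Lemma Pn_nonneg n x y : 0 <= Pn dec l P n x y.
Proof.
  revert x y; induction n as [|n IH]; intros x y; cbn [Pn].
  - destruct (dec x y); lra.
  - apply sumS_nonneg; intros z _. apply Rmult_le_pos; [apply IH|apply HP].
Qed.

Lemma Pn_sum n x : sumS l (Pn dec l P n x) = 1.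
Proof.
  revert x; induction n as [|n IH]; intros x.
  - cbn [Pn]. rewrite (sumS_single l _ x); try apply Hl.
    + now destruct (dec x x).
    + intros y _ Hy. destruct (dec x y); [now subst|reflexivity].
  - rewrite (sumS_ext l _ (fun y => sumS l (fun z => P x z * Pn dec l P n z y)))
      by (intros; apply Pn_left).
    rewrite sumS_swap.
    rewrite (sumS_ext l _ (P x)); [apply HP|].
    intros z _. rewrite sumS_scal, IH. ring.
Qed.

(* Mean of [Phi [X_0; ...; X_(m-1)]] for the chain started at [X_0 = x]. *)
Fixpoint path_mean (m : nat) (x : St) (Phi : list St -> R) : R :=
  match m with
  | O => Phi []
  | S m' => sumS l (fun w => P x w * path_mean m' w (fun s => Phi (x :: s)))
  end.

Lemma path_mean_le m x Phi Psi :
  (forall s, Phi s <= Psi s) -> path_mean m x Phi <= path_mean m x Psi.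
Proof.
  revert x Phi Psi; induction m as [|m IH]; intros x Phi Psi H; [apply H|].
  apply sumS_le; intros w _. apply Rmult_le_compat_l; [apply HP|]. apply IH; intro; apply H.
Qed.

Lemma path_mean_scal m x c Phi :
  path_mean m x (fun s => c * Phi s) = c * path_mean m x Phi.
Proof.
  revert x Phi; induction m as [|m IH]; intros x Phi; [reflexivity|].
  cbn [path_mean]. rewrite <- sumS_scal. apply sumS_ext; intros w _.
  rewrite (IH w (fun s => Phi (x :: s))). ring.
Qed.

Lemma path_mean_sum {J} (lJ : list J) m x (Phi : J -> list St -> R) :
  path_mean m x (fun s => sumS lJ (fun j => Phi j s)) = sumS lJ (fun j => path_mean m x (Phi j)).
Proof.
  revert x Phi; induction m as [|m IH]; intros x Phi; [reflexivity|].
  cbn [path_mean]. rewrite sumS_swap. apply sumS_ext; intros w _.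
  rewrite (IH w (fun j s => Phi j (x :: s))), sumS_scal. reflexivity.
Qed.

Section OneBlock.
Context (L : nat) (h : St -> R).
Hypothesis HL : (1 <= L)%nat.

(* Sum of [h] over every [L]-th entry, from the entry of index [j] on. *)
Fixpoint class_sum (j : nat) (s : list St) : R :=
  match s with
  | [] => 0
  | x :: s' => match j with
               | O => h x + class_sum (L - 1) s'
               | S j' => class_sum j' s'
               end
  end.

(** Removing the head of the path moves class j + 1 to class j and class 0 to class L - 1, so the
    classes are merely permuted. *)
Lemma class_sum_total s : sumS (seq 0 L) (fun j => class_sum j s) = sumS s h.
Proof.
  induction s as [|x s IH]; [apply sumS_zero|].
  rewrite sumS_cons, <- IH.
  assert (E1 : seq 0 L = 0%nat :: map S (seq 0 (L - 1))).
  { rewrite seq_shift. now replace L with (S (L - 1)) at 1 by lia. }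
  assert (E2 : seq 0 L = seq 0 (L - 1) ++ [(L - 1)%nat]).
  { replace L with (S (L - 1)) at 1 by lia. apply seq_S. }
  rewrite E1 at 1. rewrite E2, sumS_app, !sumS_cons, sumS_nil, sumS_map.
  cbn [class_sum]. ring.
Qed.

Context (c : R).
Local Notation class_mgf m j x := (path_mean m x (fun s => exp (c * class_sum j s))).

Lemma class_mgf_0 m x : class_mgf (S m) 0%nat x
  = exp (c * h x) * sumS l (fun w => P x w * class_mgf m (L - 1)%nat w).
Proof.
  cbn [path_mean class_sum]. rewrite <- sumS_scal. apply sumS_ext; intros w _.
  transitivity (P x w * path_mean m w (fun s => exp (c * h x) * exp (c * class_sum (L - 1) s))).
  - f_equal. f_equal. sext. rewrite <- exp_plus. f_equal. ring.
  - rewrite path_mean_scal. ring.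
Qed.

Lemma class_mgf_short m j x : (m <= j)%nat -> class_mgf m j x = 1.
Proof.
  revert j x; induction m as [|m IH]; intros j x Hj.
  - cbn [path_mean class_sum]. rewrite Rmult_0_r. apply exp_0.
  - destruct j as [|j]; [lia|]. cbn [path_mean class_sum].
    rewrite (sumS_ext l _ (P x)); [apply HP|]. intros w _. rewrite IH by lia. ring.
Qed.

Lemma class_mgf_skip m j x : (j <= m)%nat ->
  class_mgf m j x = sumS l (fun w => Pn dec l P j x w * class_mgf (m - j) 0%nat w).
Proof.
  revert m x; induction j as [|j IH]; intros m x Hj.
  - rewrite Nat.sub_0_r, (sumS_single l _ x); try apply Hl.
    + cbn [Pn]. destruct (dec x x); [ring|easy].
    + intros y _ Hy. cbn [Pn]. destruct (dec x y); [now subst|ring].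
  - destruct m as [|m]; [lia|].
    transitivity (sumS l (fun w => P x w * class_mgf m j w)); [reflexivity|].
    rewrite (sumS_ext l _ (fun w => sumS l (fun y =>
       P x w * Pn dec l P j w y * class_mgf (m - j) 0%nat y))).
    + rewrite sumS_swap. apply sumS_ext; intros y _. rewrite sumS_scal_r, Pn_left. reflexivity.
    + intros w _. rewrite IH by lia. rewrite <- sumS_scal. apply sumS_ext; intros; ring.
Qed.

Context (pi : St -> R) (err D B : R).
Hypothesis Herr : 0 <= err.
Hypothesis Hmix : forall x y, Pn dec l P L x y <= (1 + err) * pi y.
Hypothesis HD : 0 <= D.
Hypothesis HB : 1 <= B.
Hypothesis Hmgf : (1 + err) * sumS l (fun y => pi y * exp (c * h y)) <= exp D.
Hypothesis HhB : forall x, exp (c * h x) <= B.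

(** After the entry at x, the next entry of the class comes L steps later, with a law below (1 +
    [err]) pi, and so costs at most exp D. At most m/L such blocks fit into the path. *)
Lemma class_mgf_0_le m x : (1 <= m)%nat ->
  class_mgf m 0%nat x <= exp (c * h x) * exp (D * INR m / INR L).
Proof.
  revert x; induction m as [m IH] using lt_wf_ind; intros x Hm.
  assert (HLr : 0 < INR L) by (apply lt_0_INR; lia).
  destruct m as [|m]; [lia|]. rewrite class_mgf_0.
  apply Rmult_le_compat_l; [left; apply exp_pos|].
  destruct (le_lt_dec m (L - 1)) as [C|C].
  - rewrite (sumS_ext l _ (P x)) by (intros w _; rewrite class_mgf_short by lia; ring).
    rewrite (proj2 HP), <- exp_0. apply exp_le_mono.
    apply Rmult_le_pos; [apply Rmult_le_pos; [exact HD|apply pos_INR]|].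
    left; now apply Rinv_0_lt_compat.
  - transitivity (class_mgf (S m) (S (L - 1)) x); [right; reflexivity|].
    rewrite class_mgf_skip by lia. replace (S (L - 1)) with L by lia.
    set (e := exp (D * INR (S m - L) / INR L)).
    apply Rle_trans with (sumS l (fun w => ((1 + err) * e) * (pi w * exp (c * h w)))).
    + apply sumS_le; intros w _.
      assert (H1 := IH (S m - L)%nat ltac:(lia) w ltac:(lia)). fold e in H1.
      assert (H2 : 0 <= exp (c * h w) * e) by (apply Rmult_le_pos; left; apply exp_pos).
      apply Rle_trans with (Pn dec l P L x w * (exp (c * h w) * e)).
      * apply Rmult_le_compat_l; [apply Pn_nonneg|exact H1].
      * apply Rle_trans with ((1 + err) * pi w * (exp (c * h w) * e)).
        -- now apply Rmult_le_compat_r.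
        -- right; ring.
    + rewrite sumS_scal. apply Rle_trans with (e * exp D).
      * rewrite (Rmult_comm _ e), Rmult_assoc.
        apply Rmult_le_compat_l; [left; apply exp_pos|exact Hmgf].
      * right. unfold e. rewrite <- exp_plus. f_equal.
        rewrite minus_INR by lia. field. lra.
Qed.

(** The first entry of the class is reached too early to be near pi; the crude bound B pays for
    it. *)
Lemma class_mgf_le m j x : class_mgf m j x <= B * exp (D * INR m / INR L).
Proof.
  assert (HLr : 0 < INR L) by (apply lt_0_INR; lia).
  assert (Hmono : forall i, (i <= m)%nat ->
    exp (D * INR i / INR L) <= exp (D * INR m / INR L)).
  { intros i Hi. apply le_INR in Hi.
    apply exp_le_mono, Rmult_le_compat_r; [left; now apply Rinv_0_lt_compat|].
    now apply Rmult_le_compat_l. }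
  destruct (le_lt_dec m j) as [C|C].
  - rewrite class_mgf_short by assumption.
    pose proof (Hmono 0%nat (Nat.le_0_l m)) as H. cbn [INR] in H.
    replace (D * 0 / INR L) with 0 in H by (field; lra). rewrite exp_0 in H. nra.
  - rewrite class_mgf_skip by lia.
    apply Rle_trans with (sumS l (fun w => (B * exp (D * INR m / INR L)) * Pn dec l P j x w)).
    + apply sumS_le; intros w _. rewrite (Rmult_comm _ (Pn _ _ _ _ _ _)).
      apply Rmult_le_compat_l; [apply Pn_nonneg|].
      eapply Rle_trans; [apply class_mgf_0_le; lia|].
      apply Rmult_le_compat; try (left; apply exp_pos); [apply HhB|apply Hmono; lia].
    + rewrite sumS_scal, Pn_sum. right; ring.
Qed.
End OneBlock.

(* Splitting the path into its residue classes modulo [L], the convexity of [exp]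
   reduces the estimate to sums over times a whole block [L] apart, which behave like
   independent draws from [pi] up to the factor [1 + err]. *)
Lemma path_mgf_le L h (pi : St -> R) err D B m x : (1 <= L)%nat -> 0 <= err ->
  (forall x y, Pn dec l P L x y <= (1 + err) * pi y) -> 0 <= D -> 1 <= B ->
  (1 + err) * sumS l (fun y => pi y * exp (INR L * h y)) <= exp D ->
  (forall x, exp (INR L * h x) <= B) ->
  path_mean m x (fun s => exp (sumS s h)) <= B * exp (D * INR m / INR L).
Proof.
  intros HL Herr Hmix HD HB Hmgf HhB.
  assert (HLr : 0 < INR L) by (apply lt_0_INR; lia).
  apply Rle_trans with (path_mean m x (fun s => / INR L *
     sumS (seq 0 L) (fun j => exp (INR L * class_sum L h j s)))).
  - apply path_mean_le. intro s. rewrite <- (class_sum_total L h HL s).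
    pose proof (exp_sum_le_mean (seq 0 L) (fun j => class_sum L h j s)) as H.
    rewrite length_seq in H. apply H. destruct L; [lia|easy].
  - rewrite path_mean_scal, path_mean_sum.
    apply Rle_trans with (/ INR L * sumS (seq 0 L) (fun _ => B * exp (D * INR m / INR L) * 1)).
    + apply Rmult_le_compat_l; [left; now apply Rinv_0_lt_compat|].
      apply sumS_le; intros j _. rewrite Rmult_1_r.
      now apply class_mgf_le with pi err.
    + rewrite sumS_scal.
      assert (Hc : forall a k, sumS (seq a k) (fun _ => 1) = INR k).
      { intros a k; revert a; induction k as [|k IH]; intro a; [reflexivity|].
        cbn [seq]. rewrite sumS_cons, IH, S_INR. ring. }
      rewrite Hc. right. field. lra.
Qed.
End Blocks.

(** * Chernoff bounds for the failure counts of a Markov chain *)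

Section TailBound.
Context {St : Type} (dec : forall x y : St, {x = y} + {x <> y}) (l : list St)
  (P : St -> St -> R) (pi nu : St -> R).
Hypothesis Hl : finite_enum l.
Hypothesis HP : stochastic l P.
Hypothesis Hpi : invariant l P pi.
Hypothesis Hnu : is_distribution l nu.

Definition chain_kernel (o : option St) : St -> R :=
  match o with None => nu | Some x => P x end.

Lemma chain_kernel_kernel : kernel l chain_kernel.
Proof.
  split; intros [x|]; cbn [chain_kernel]; try apply HP; try apply Hnu.
Qed.

Context (z : St).
Hypothesis Hz : 0 < pi z.
Local Notation p x := (P x z).

(** This is Var(rho_z) / g(z)^2, from which the measure mu has cancelled; see [variance_rho]. *)
Definition rel_var : R := sumS l (fun x => pi x * (P x z - pi z) ^ 2) / pi z ^ 2.

Lemma rel_var_nonneg : 0 <= rel_var.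
Proof.
  apply Rmult_le_pos.
  - apply sumS_nonneg; intros x _. apply Rmult_le_pos; [apply Hpi|apply pow2_ge_0].
  - left. apply Rinv_0_lt_compat, pow_lt, Hz.
Qed.

Lemma chain_mgf_le L (err b tau theta : R) m x :
  (1 <= L)%nat -> 0 <= err ->
  (forall x y, Pn dec l P L x y <= (1 + err) * pi y) ->
  (forall x, p x <= b) -> pi z <= b -> theta * nu z < 1 ->
  Rabs theta * pi z = tau -> 8 * INR L * tau * b <= pi z ->
  mgf l chain_kernel z theta m (Some x)
  <= exp 1 * exp (INR m * (theta * pi z + 4 * tau ^ 2 + 9 * INR L * rel_var * tau ^ 2 + err / INR L)).
Proof.
  intros HL Herr Hmix Hb Hpb Hnz Htau HLb.
  assert (HL1 : 1 <= INR L) by (apply (le_INR 1); lia).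
  assert (HP0 : forall x, 0 <= p x) by (intro; apply HP).
  assert (Hpi0 : forall x, 0 <= pi x) by apply Hpi.
  assert (Ht2 : theta ^ 2 * pi z ^ 2 = tau ^ 2)
    by (rewrite <- Htau, Rpow_mult_distr, pow2_abs; ring).
  assert (Htb : INR L * (Rabs theta * b) <= / 8).
  { apply (Rmult_le_reg_r (pi z)); [assumption|]. rewrite <- Htau in HLb. lra. }
  assert (Htb0 : 0 <= Rabs theta * b) by (apply Rmult_le_pos; [apply Rabs_pos|lra]).
  assert (Hu : forall y, theta * p y <= / 2).
  { intro y. apply Rle_trans with (Rabs theta * b); [|nra].
    apply Rle_trans with (Rabs theta * p y).
    - apply Rmult_le_compat_r; [apply HP0|apply Rle_abs].
    - apply Rmult_le_compat_l; [apply Rabs_pos|apply Hb]. }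
  set (D := fun x => p x - pi z).
  (* With u = theta p, 1/(1 - u) <= exp(u + 2 u^2) and p^2 <= 2 (pi z)^2 + 2 D^2 split the exponent
     into the constant [c] and [h], whose linear part has mean 0 under pi. *)
  set (h := fun x => theta * D x + 4 * theta ^ 2 * D x ^ 2).
  set (c := theta * pi z + 4 * tau ^ 2).
  assert (Hstep : forall x, / (1 - theta * p x) <= exp (c + h x)).
  { intro y. eapply Rle_trans; [apply inv_le_exp, Hu|]. apply exp_le_mono.
    unfold h, c, D. rewrite <- Ht2.
    assert (0 <= theta ^ 2 * (p y - 2 * pi z) ^ 2) by (apply Rmult_le_pos; apply pow2_ge_0).
    nra. }
  assert (Hpath : forall m x, mgf l chain_kernel z theta m (Some x)
     <= exp (INR m * c) * path_mean l P m x (fun s => exp (sumS s h))).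
  { clear m x. induction m as [|m IH]; intro x.
    - cbn [mgf path_mean INR]. rewrite Rmult_0_l, sumS_nil, !exp_0. lra.
    - cbn [mgf path_mean chain_kernel].
      apply Rle_trans with (exp (c + h x) *
        sumS l (fun w => P x w * (exp (INR m * c) * path_mean l P m w (fun s => exp (sumS s h))))).
      + apply Rmult_le_compat; [| |apply Hstep|].
        * left. apply Rinv_0_lt_compat. specialize (Hu x). lra.
        * apply sumS_nonneg; intros w _. apply Rmult_le_pos; [apply HP|].
          apply (mgf_nonneg l _ chain_kernel_kernel).
          intros [y|]; cbn [chain_kernel]; [specialize (Hu y); lra|exact Hnz].
        * apply sumS_le; intros w _. apply Rmult_le_compat_l; [apply HP|apply IH].
      + right. rewrite <- !sumS_scal. apply sumS_ext; intros w _.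
        transitivity (exp (INR (S m) * c) * (P x w *
           path_mean l P m w (fun s => exp (h x) * exp (sumS s h)))).
        * rewrite path_mean_scal, S_INR, Rmult_plus_distr_r, Rmult_1_l, !exp_plus. ring.
        * f_equal. f_equal. f_equal. sext. now rewrite <- exp_plus, sumS_cons. }
  assert (HD : forall x, Rabs (D x) <= b).
  { intro y. unfold D. specialize (HP0 y). specialize (Hb y). apply Rabs_le. lra. }
  (* [v] is the linear part of L h. Since |v| <= 1/8 and v <= L h <= v + 4 v^2, one gets exp(L h) <=
     1 + v + 9 v^2, whose pi-mean is 1 plus 9 times the second moment of v. *)
  set (v := fun x => INR L * theta * D x).
  assert (Hv : forall x, Rabs (v x) <= / 8).
  { intro y. unfold v. rewrite !Rabs_mult, (Rabs_pos_eq (INR L)) by lra.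
    apply Rle_trans with (INR L * (Rabs theta * b)); [|exact Htb].
    rewrite Rmult_assoc. apply Rmult_le_compat_l; [lra|].
    apply Rmult_le_compat_l; [apply Rabs_pos|apply HD]. }
  assert (HLh : forall x, INR L * h x <= v x + 4 * v x ^ 2 /\ v x <= INR L * h x).
  { intro y. unfold h, v.
    assert (0 <= theta ^ 2 * D y ^ 2) by (apply Rmult_le_pos; apply pow2_ge_0).
    assert (INR L <= INR L ^ 2) by nra.
    replace ((INR L * theta * D y) ^ 2) with (INR L ^ 2 * (theta ^ 2 * D y ^ 2)) by ring.
    split; nra. }
  assert (Hvb : forall x, - / 8 <= v x <= / 8).
  { intro y. specialize (Hv y). unfold Rabs in Hv. destruct (Rcase_abs (v y)); lra. }
  assert (Hvar : sumS l (fun y => pi y * v y ^ 2) = INR L ^ 2 * (rel_var * tau ^ 2)).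
  { rewrite (sumS_ext l _ (fun y => (INR L ^ 2 * theta ^ 2) * (pi y * D y ^ 2)))
      by (intros; unfold v; ring).
    rewrite sumS_scal. unfold rel_var. fold D. rewrite <- Ht2. unfold D. field. lra. }
  assert (Hmean : sumS l (fun y => pi y * v y) = 0).
  { rewrite (sumS_ext l _ (fun y => (INR L * theta) * (pi y * p y - pi z * pi y)))
      by (intros; unfold v, D; ring).
    rewrite sumS_scal, sumS_minus, sumS_scal, (proj2 Hpi), (proj2 (proj1 Hpi)). ring. }
  set (Q2 := 9 * INR L ^ 2 * (rel_var * tau ^ 2)).
  assert (HQ2 : 0 <= rel_var * tau ^ 2).
  { apply Rmult_le_pos; [apply rel_var_nonneg|apply pow2_ge_0]. }
  assert (Hmgf : sumS l (fun y => pi y * exp (INR L * h y)) <= exp Q2).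
  { apply Rle_trans with (1 + Q2); [|apply exp_ineq1_le].
    apply Rle_trans with (sumS l (fun y => (pi y + pi y * v y) + 9 * (pi y * v y ^ 2))).
    - apply sumS_le; intros y _. specialize (Hvb y). destruct (HLh y) as [H1 H2].
      assert (Hv2 : 0 <= v y ^ 2) by apply pow2_ge_0.
      assert (H3 : (INR L * h y) ^ 2 <= 2.25 * v y ^ 2).
      { assert (v y * v y = v y ^ 2) by ring.
        assert (v y ^ 2 <= / 64) by nra.
        assert (v y ^ 2 * v y ^ 2 <= / 64 * v y ^ 2) by nra.
        set (t := INR L * h y) in *. set (r := t - v y).
        assert (Hr : 0 <= r <= 4 * v y ^ 2) by (unfold r; lra).
        assert (Hr2 : r ^ 2 <= 16 * (v y ^ 2 * v y ^ 2)) by nra.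
        assert (Hrv : r * v y <= 4 * v y ^ 2 * / 8) by nra.
        replace (t ^ 2) with (v y ^ 2 + 2 * (r * v y) + r ^ 2) by (unfold r; ring). lra. }
      assert (Hexp : exp (INR L * h y) <= 1 + v y + 9 * v y ^ 2).
      { eapply Rle_trans; [apply exp_le_quadratic; nra|]. lra. }
      specialize (Hpi0 y). nra.
    - rewrite !sumS_plus, sumS_scal, Hvar, Hmean, (proj2 (proj1 Hpi)). unfold Q2. lra. }
  assert (Herr' : 1 + err <= exp err) by apply exp_ineq1_le.
  apply Rle_trans with (exp (INR m * c) * (exp 1 * exp ((err + Q2) * INR m / INR L))).
  - eapply Rle_trans; [apply Hpath|]. apply Rmult_le_compat_l; [left; apply exp_pos|].
    apply (path_mgf_le dec l P Hl HP L h pi err); try assumption.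
    + unfold Q2. assert (0 <= INR L ^ 2) by apply pow2_ge_0. nra.
    + pose proof (exp_ineq1_le 1). lra.
    + rewrite exp_plus. apply Rmult_le_compat; try lra.
      apply sumS_nonneg; intros y _. apply Rmult_le_pos; [apply Hpi0|left; apply exp_pos].
    + intro y. apply exp_le_mono. specialize (Hvb y). destruct (HLh y). nra.
  - right. rewrite <- !exp_plus. f_equal. unfold c, Q2. field. lra.
Qed.

(* [s] is 1 for the upper tail and -1 for the lower one. *)
Lemma chain_fails_tail (d : R) L (err b tau eps s alpha n : R) m N :
  0 < d -> d <= / 2 -> 2 * d <= pi z ->
  (1 <= L)%nat -> 0 <= err ->
  (forall x y, Pn dec l P L x y <= (1 + err) * pi y) ->
  (forall x, p x <= b) -> pi z <= b ->
  s = 1 \/ s = - 1 -> 0 < tau -> 0 < eps -> eps <= / 2 -> s * tau * nu z <= pi z / 2 ->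
  8 * INR L * tau * b <= pi z ->
  144 * tau * (1 + INR L * rel_var) <= eps ->
  16 * err <= INR L * tau * eps ->
  n * eps / 2 - 1 <= s * (alpha - INR m) -> 0 <= alpha -> alpha <= 2 * n -> INR m <= 2 * n ->
  run_mean l d chain_kernel N (fun g => ind ((S m <= length (succs g))%nat /\
     0 <= s * (INR (fails dec z (S m) g) - pi z * ((1 - d) / d) * alpha)))
  <= 2 * exp 2 * exp (- (n * tau * eps / 4)).
Proof.
  intros Hd0 Hd Hdz HL Herr Hmix Hb Hpb Hs Htau Heps0 Heps Hnz HLb HV Herr2 Hal Hal0 Hal2 Hm2.
  assert (HL1 : 1 <= INR L) by (apply (le_INR 1); lia).
  set (theta := s * tau / pi z). set (eta := d * theta / (1 - d)).
  assert (Hs2 : s * s = 1) by (destruct Hs as [-> | ->]; ring).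
  assert (Habs : Rabs theta * pi z = tau).
  { unfold theta, Rdiv. rewrite !Rabs_mult, (Rabs_pos_eq tau) by lra.
    rewrite (Rabs_pos_eq (/ pi z)) by (left; now apply Rinv_0_lt_compat).
    replace (Rabs s) with 1; [field; lra|].
    unfold Rabs. destruct Hs as [-> | ->]; destruct Rcase_abs; lra. }
  assert (Htz : theta * pi z = s * tau) by (unfold theta; field; lra).
  assert (Hrv := rel_var_nonneg).
  assert (HLrv : 0 <= INR L * rel_var) by (apply Rmult_le_pos; lra).
  assert (Htau1 : 144 * tau <= eps) by nra.
  assert (Hse : s * eta = (d / (pi z * (1 - d))) * tau).
  { unfold eta, theta. replace (s * (d * (s * tau / pi z) / (1 - d)))
      with ((s * s) * (d * tau / pi z / (1 - d))) by (field; lra).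
    rewrite Hs2. field. lra. }
  (* From 2 d <= pi z and d <= 1/2; consequently |eta| <= tau. *)
  assert (Hq : 0 <= d / (pi z * (1 - d)) <= 1).
  { split.
    - apply Rmult_le_pos; [lra|]. left. apply Rinv_0_lt_compat. nra.
    - apply (Rmult_le_reg_r (pi z * (1 - d))); [nra|].
      unfold Rdiv. rewrite Rmult_assoc, Rinv_l by nra. nra. }
  assert (Heta : 0 <= s * eta <= tau) by (rewrite Hse; nra).
  assert (Heta2 : - / 2 <= eta) by (destruct Hs as [-> | ->]; lra).
  assert (Htn : theta * nu z <= / 2).
  { apply (Rmult_le_reg_r (pi z)); [assumption|].
    replace (theta * nu z * pi z) with (s * tau * nu z) by (unfold theta; field; lra). lra. }
  assert (Hnu0 : 0 <= nu z) by apply Hnu.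
  assert (Hlt : forall o, theta * chain_kernel o z < 1).
  { intros [x|]; cbn [chain_kernel]; [|lra].
    apply Rle_lt_trans with (Rabs theta * b).
    - apply Rle_trans with (Rabs theta * p x).
      + apply Rmult_le_compat_r; [apply HP|apply Rle_abs].
      + apply Rmult_le_compat_l; [apply Rabs_pos|apply Hb].
    - apply (Rmult_lt_reg_r (pi z)); [assumption|].
      replace (Rabs theta * b * pi z) with (Rabs theta * pi z * b) by ring. rewrite Habs.
      assert (0 < tau * b) by (apply Rmult_lt_0_compat; lra). nra. }
  assert (Hth0 : theta <> 0).
  { intro E. rewrite E, Rabs_R0 in Habs. lra. }
  assert (Heq : (1 - d) * eta = d * theta) by (unfold eta; field; lra).
  set (a := pi z * ((1 - d) / d) * alpha).
  apply Rle_trans with (exp (- ln (1 + eta) * a) * mgf l chain_kernel z theta (S m) None).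
  { eapply Rle_trans; [|apply (fails_tail dec l d Hl (conj Hd0 (ltac:(lra) : d < 1)) chain_kernel
       chain_kernel_kernel z theta eta Hth0 Heq ltac:(lra) Hlt N (S m) a)].
    apply run_mean_le; [lra|exact chain_kernel_kernel|]. intro g. apply ind_le.
    intros [H1 H2]. split; [exact H1|]. fold a in H2.
    replace (theta * (INR (fails dec z (S m) g) - a))
      with ((tau / pi z) * (s * (INR (fails dec z (S m) g) - a))) by (unfold theta; field; lra).
    apply Rmult_le_pos; [|exact H2]. apply Rmult_le_pos; [lra|].
    left. now apply Rinv_0_lt_compat. }
  set (G := theta * pi z + 4 * tau ^ 2 + 9 * INR L * rel_var * tau ^ 2 + err / INR L).
  (* The first draw has law nu and costs a factor 1 / (1 - theta nu z) <= 2; only the m later steps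
     obey the chain estimate. *)
  assert (Hmgf : mgf l chain_kernel z theta (S m) None <= 2 * (exp 1 * exp (INR m * G))).
  { cbn [mgf]. cbn [chain_kernel].
    apply Rmult_le_compat.
    - left. apply Rinv_0_lt_compat. lra.
    - apply sumS_nonneg; intros w _. apply Rmult_le_pos; [apply Hnu|].
      now apply (mgf_nonneg l _ chain_kernel_kernel).
    - rewrite <- (Rinv_inv 2). apply Rinv_le_contravar; lra.
    - apply Rle_trans with (sumS l (fun w => (exp 1 * exp (INR m * G)) * nu w)).
      + apply sumS_le; intros w _. rewrite (Rmult_comm _ (nu w)).
        apply Rmult_le_compat_l; [apply Hnu|].
        apply (chain_mgf_le L err b); try assumption. lra.
      + rewrite sumS_scal, (proj2 Hnu). right; ring. }
  (* The factor pi z (1 - d)/d in the level turns eta into exactly s tau; the rest is ln(1 + eta) >=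
     eta - 2 eta^2. *)
  assert (Hlam : - ln (1 + eta) * a <= - (s * tau) * alpha + 2 * tau ^ 2 * alpha).
  { pose proof (ln_ge_quadratic eta Heta2) as Hln.
    assert (Ha0 : 0 <= pi z * ((1 - d) / d)).
    { apply Rmult_le_pos; [lra|]. apply Rmult_le_pos; [lra|]. left. now apply Rinv_0_lt_compat. }
    apply Rle_trans with ((- eta + 2 * eta ^ 2) * a).
    { apply Rmult_le_compat_r; [now apply Rmult_le_pos|lra]. }
    assert (E1 : pi z * ((1 - d) / d) * eta = s * tau)
      by (unfold eta, theta; field; lra).
    replace ((- eta + 2 * eta ^ 2) * a)
      with ((pi z * ((1 - d) / d) * eta) * (- 1 + 2 * eta) * alpha) by (unfold a; ring).
    rewrite E1.
    assert (tau * (s * eta) <= tau * tau) by (apply Rmult_le_compat_l; lra).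
    assert (s * tau * eta <= tau ^ 2) by nra. nra. }
  apply Rle_trans with (exp (- (s * tau) * alpha + 2 * tau ^ 2 * alpha)
                        * (2 * (exp 1 * exp (INR m * G)))).
  { apply Rmult_le_compat; [left; apply exp_pos| |now apply exp_le_mono|exact Hmgf].
    apply mgf_nonneg; [exact chain_kernel_kernel|exact Hlt]. }
  (* The main term gains tau (n eps/2 - 1), and the errors take back at most n tau eps/4. In exp 2,
     one unit is the constant of [Hmgf] and the other bounds tau, the cost of rounding. *)
  apply Rle_trans with (2 * exp (1 + (1 - n * tau * eps / 4))).
  2:{ right. replace (1 + (1 - n * tau * eps / 4)) with (2 + - (n * tau * eps / 4)) by ring.
      rewrite exp_plus. ring. }
  replace (exp (- (s * tau) * alpha + 2 * tau ^ 2 * alpha) * (2 * (exp 1 * exp (INR m * G))))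
    with (2 * exp (- (s * tau) * alpha + 2 * tau ^ 2 * alpha + (1 + INR m * G)))
    by (rewrite !exp_plus; ring).
  apply Rmult_le_compat_l; [lra|]. apply exp_le_mono.
  unfold G. rewrite Htz.
  pose proof (pos_INR m) as Hm0.
  assert (HerrL : err / INR L <= tau * eps / 16).
  { apply (Rmult_le_reg_r (INR L)); [lra|]. unfold Rdiv at 1.
    rewrite Rmult_assoc, Rinv_l by lra. nra. }
  assert (Hg : 4 * tau ^ 2 + 9 * INR L * rel_var * tau ^ 2 + err / INR L
               <= 9 * tau ^ 2 * (1 + INR L * rel_var) - 5 * tau ^ 2 + tau * eps / 16) by nra.
  assert (Hg0 : 0 <= err / INR L)
    by (apply Rmult_le_pos; [lra|left; apply Rinv_0_lt_compat; lra]).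
  assert (Ht0 : 0 <= tau ^ 2) by apply pow2_ge_0.
  assert (Hg2 : 9 * tau ^ 2 * (1 + INR L * rel_var) <= tau * eps / 16) by nra.
  assert (Hmg : INR m * (4 * tau ^ 2 + 9 * INR L * rel_var * tau ^ 2 + err / INR L)
      <= 2 * n * (tau * eps / 8 - 5 * tau ^ 2)).
  { apply Rle_trans with (INR m * (tau * eps / 8 - 5 * tau ^ 2)).
    - apply Rmult_le_compat_l; lra.
    - apply Rmult_le_compat_r; [nra|exact Hm2]. }
  assert (Hal3 : tau * (n * eps / 2 - 1) <= tau * (s * (alpha - INR m)))
    by (apply Rmult_le_compat_l; lra).
  assert (tau <= / 2) by lra.
  assert (2 * tau ^ 2 * alpha <= 4 * tau ^ 2 * n) by nra.
  assert (0 <= tau ^ 2 * n) by (apply Rmult_le_pos; lra).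
  replace (INR m * (s * tau + 4 * tau ^ 2 + 9 * INR L * rel_var * tau ^ 2 + err / INR L))
    with (INR m * (s * tau) + INR m * (4 * tau ^ 2 + 9 * INR L * rel_var * tau ^ 2 + err / INR L))
    by ring.
  nra.
Qed.
End TailBound.

(** * Mixing and choice of parameters *)

Section Mixing.
Context {St : Type} (dec : forall x y : St, {x = y} + {x <> y}) (l : list St)
  (P : St -> St -> R) (pi : St -> R).
Hypothesis Hl : finite_enum l.
Hypothesis HP : stochastic l P.
Hypothesis Hpi : invariant l P pi.

Lemma Pn_add n m x y :
  Pn dec l P (n + m) x y = sumS l (fun z => Pn dec l P n x z * Pn dec l P m z y).
Proof.
  revert x; induction n as [|n IH]; intro x.
  - rewrite (sumS_single l _ x); try apply Hl.
    + cbn [Pn Nat.add]. destruct (dec x x); [ring|easy].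
    + intros z _ Hz. cbn [Pn]. destruct (dec x z); [now subst|ring].
  - cbn [Nat.add]. rewrite (Pn_left dec l P Hl).
    rewrite (sumS_ext l _ (fun w => sumS l (fun z =>
       P x w * Pn dec l P n w z * Pn dec l P m z y))).
    + rewrite sumS_swap. apply sumS_ext; intros z _.
      now rewrite sumS_scal_r, <- (Pn_left dec l P Hl).
    + intros w _. rewrite IH, <- sumS_scal. apply sumS_ext; intros; ring.
Qed.

Lemma invariant_Pn n y : sumS l (fun x => pi x * Pn dec l P n x y) = pi y.
Proof.
  revert y; induction n as [|n IH]; intro y.
  - rewrite (sumS_single l _ y); try apply Hl.
    + cbn [Pn]. destruct (dec y y); [ring|easy].
    + intros z _ Hz. cbn [Pn]. destruct (dec z y); [easy|ring].
  - cbn [Pn].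
    rewrite (sumS_ext l _ (fun x => sumS l (fun z => pi x * Pn dec l P n x z * P z y)))
      by (intros; rewrite <- sumS_scal; apply sumS_ext; intros; ring).
    rewrite sumS_swap, <- (proj2 Hpi y). apply sumS_ext; intros z _.
    now rewrite sumS_scal_r, IH.
Qed.

Lemma invariant_pos : irreducible dec l P -> forall y, 0 < pi y.
Proof.
  intros Hirr y. destruct Hpi as [[H0 H1] _].
  assert (Hx : exists x, 0 < pi x).
  { apply NNPP. intro H. assert (E : sumS l pi <= 0).
    { rewrite <- (sumS_zero l). apply sumS_le. intros x _.
      destruct (Rle_lt_dec (pi x) 0); [assumption|exfalso; apply H; now exists x]. }
    lra. }
  destruct Hx as [x Hx]. destruct (Hirr x y) as [n Hn].
  rewrite <- (invariant_Pn n y).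
  apply Rlt_le_trans with (pi x * Pn dec l P n x y); [now apply Rmult_lt_0_compat|].
  apply (sumS_ge_term l (fun x => pi x * Pn dec l P n x y)); [|apply Hl].
  intros z _. apply Rmult_le_pos; [apply H0|now apply Pn_nonneg].
Qed.

(** The cross terms cancel by invariance of pi and by rows summing to 1: the centred powers form a
    semigroup. *)
Lemma centered_Pn_add n m x y :
  Pn dec l P (n + m) x y - pi y
  = sumS l (fun z => (Pn dec l P n x z - pi z) * (Pn dec l P m z y - pi y)).
Proof.
  rewrite Pn_add.
  rewrite (sumS_ext l (fun z => (Pn dec l P n x z - pi z) * (Pn dec l P m z y - pi y))
    (fun z => (Pn dec l P n x z * Pn dec l P m z y - pi y * Pn dec l P n x z)
              - (pi z * Pn dec l P m z y - pi y * pi z))) by (intros; ring).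
  rewrite !sumS_minus, !sumS_scal, invariant_Pn, (Pn_sum dec l P Hl HP), (proj2 (proj1 Hpi)).
  ring.
Qed.

(** The l1 distance is twice the total variation, so it is at most 1/2 at time T;
    submultiplicativity of the centred powers halves it at each further T. *)
Lemma mixing_decay T j x : is_mixing_time dec l P pi T ->
  sumS l (fun y => Rabs (Pn dec l P (S j * T) x y - pi y)) <= (/ 2) ^ S j.
Proof.
  intros [HT _]. unfold tv in HT. revert x; induction j as [|j IH]; intro x.
  - cbn [Nat.mul pow]. rewrite Nat.add_0_r. specialize (HT x). lra.
  - replace (S (S j) * T)%nat with (T + S j * T)%nat by (cbn [Nat.mul]; lia).
    apply Rle_trans with (sumS l (fun y => sumS l (fun z =>
       Rabs (Pn dec l P T x z - pi z) * Rabs (Pn dec l P (S j * T) z y - pi y)))).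
    + apply sumS_le; intros y _. rewrite centered_Pn_add.
      eapply Rle_trans; [apply sumS_Rabs|]. right. apply sumS_ext; intros z _. apply Rabs_mult.
    + rewrite sumS_swap.
      apply Rle_trans with (sumS l (fun z => (/ 2) ^ S j * Rabs (Pn dec l P T x z - pi z))).
      * apply sumS_le; intros z _. rewrite sumS_scal, Rmult_comm.
        apply Rmult_le_compat_r; [apply Rabs_pos|apply IH].
      * rewrite sumS_scal. change ((/ 2) ^ S (S j)) with (/ 2 * (/ 2) ^ S j).
        rewrite Rmult_comm. apply Rmult_le_compat_r; [apply pow_le; lra|].
        specialize (HT x). lra.
Qed.

Lemma Pn_near_invariant T j x y : is_mixing_time dec l P pi T -> (1 <= j)%nat ->
  Rabs (Pn dec l P (j * T) x y - pi y) <= (/ 2) ^ j.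
Proof.
  intros HT Hj. destruct j as [|j]; [lia|].
  eapply Rle_trans; [|apply (mixing_decay T j x HT)].
  apply (sumS_ge_term l (fun y => Rabs (Pn dec l P (S j * T) x y - pi y)));
    [intros; apply Rabs_pos|apply Hl].
Qed.

(** A point mass within 1/4 of pi gives its point mass at least 3/4 under pi, which two distinct
    points cannot share. *)
Lemma mixing_time_0 (x y : St) : is_mixing_time dec l P pi 0 -> x = y.
Proof.
  intro HT. destruct (dec x y) as [E|n]; [exact E|exfalso].
  assert (H : forall z, 3 / 4 <= pi z).
  { intro z. pose proof (Pn_near_invariant 0 2 z z HT ltac:(lia)) as H.
    cbn [Nat.mul Nat.add Pn pow] in H. destruct (dec z z); [|easy].
    unfold Rabs in H. destruct Rcase_abs; lra. }
  assert (Hsum : sumS l (fun z => (if dec z x then pi z else 0) + (if dec z y then pi z else 0))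
                 <= sumS l pi).
  { apply sumS_le; intros z _. specialize (H z).
    destruct (dec z x), (dec z y); try lra. congruence. }
  rewrite sumS_plus, (proj2 (proj1 Hpi)) in Hsum.
  rewrite (sumS_single l (fun z => if dec z x then pi z else 0) x) in Hsum; try apply Hl.
  2:{ intros z _ Hz. now destruct (dec z x). }
  rewrite (sumS_single l (fun z => if dec z y then pi z else 0) y) in Hsum; try apply Hl.
  2:{ intros z _ Hz. now destruct (dec z y). }
  destruct (dec x x), (dec y y); try easy.
  pose proof (H x). pose proof (H y). lra.
Qed.
End Mixing.

Lemma minS_le {A} (l : list A) f x : In x l -> minS l f <= f x.
Proof.
  destruct l as [|a l]; [easy|]. cbn [minS].
  assert (H : fold_right (fun y acc => Rmin (f y) acc) (f a) l <= f a /\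
    forall y, In y l -> fold_right (fun y acc => Rmin (f y) acc) (f a) l <= f y).
  { induction l as [|b l [IH1 IH2]]; cbn [fold_right].
    - split; [lra|easy].
    - split; [eapply Rle_trans; [apply Rmin_r|exact IH1]|].
      intros y [<-|Hy]; [apply Rmin_l|]. eapply Rle_trans; [apply Rmin_r|now apply IH2]. }
  destruct H as [Ha Hr]. intros [<-|Hx]; [exact Ha|now apply Hr].
Qed.

Lemma minS_pos {A} (l : list A) f : l <> [] -> (forall x, 0 < f x) -> 0 < minS l f.
Proof.
  destruct l as [|a l]; [easy|]. intros _ Hf. cbn [minS].
  induction l as [|b l IH]; cbn [fold_right]; [apply Hf|]. apply Rmin_glb_lt; [apply Hf|exact IH].
Qed.

Lemma maxS_ge {A} (l : list A) f x : In x l -> f x <= maxS l f.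
Proof.
  destruct l as [|a l]; [easy|]. cbn [maxS].
  assert (H : f a <= fold_right (fun y acc => Rmax (f y) acc) (f a) l /\
    forall y, In y l -> f y <= fold_right (fun y acc => Rmax (f y) acc) (f a) l).
  { induction l as [|b l [IH1 IH2]]; cbn [fold_right].
    - split; [lra|easy].
    - split; [eapply Rle_trans; [exact IH1|apply Rmax_r]|].
      intros y [<-|Hy]; [apply Rmax_l|]. eapply Rle_trans; [now apply IH2|apply Rmax_r]. }
  destruct H as [Ha Hr]. intros [<-|Hx]; [exact Ha|now apply Hr].
Qed.

Lemma nat_count_below r : 0 <= r -> exists m : nat,
  INR m <= r /\ r < INR m + 1 /\ forall i, INR i <= r <-> (i < S m)%nat.
Proof.
  intro Hr. exists (Z.to_nat (up r - 1)).
  destruct (archimed r) as [H1 H2].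
  assert (H0 : (0 < up r)%Z) by (apply lt_IZR; lra).
  assert (E : INR (Z.to_nat (up r - 1)) = IZR (up r) - 1).
  { rewrite INR_IZR_INZ, Z2Nat.id, minus_IZR by lia. reflexivity. }
  rewrite E. split; [lra|split; [lra|]]. intro i. rewrite INR_IZR_INZ. split; intro H.
  - assert (IZR (Z.of_nat i) < IZR (up r)) by lra. apply lt_IZR in H3. lia.
  - assert (Z.of_nat i <= up r - 1)%Z by lia. apply IZR_le in H3.
    rewrite minus_IZR in H3. lra.
Qed.

Lemma nat_ceil r : 0 <= r -> exists K : nat, r <= INR K /\ INR K <= r + 1.
Proof.
  intro Hr. destruct (nat_count_below r Hr) as [m [H1 [H2 _]]].
  exists (S m). rewrite S_INR. lra.
Qed.

(** * Admissible tilts and the resulting tails *)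

Section TiltChoice.
Context {St : Type} (dec : forall x y : St, {x = y} + {x <> y}) (l : list St)
  (P : St -> St -> R) (pi nu : St -> R).
Hypothesis Hl : finite_enum l.
Hypothesis HP : stochastic l P.
Hypothesis Hpi : invariant l P pi.
Hypothesis Hnu : is_distribution l nu.
Context (z : St) (pstar : R).
Hypothesis Hstar : 0 < pstar.
Hypothesis Hstar_le : forall x, pstar <= pi x.
Hypothesis Hstar_1 : pstar <= 1.

Lemma variance_rho mu : 0 < mu z ->
  variance l pi (rho_col P mu z) = rel_var l P pi z * gfun pi mu z ^ 2.
Proof.
  intro Hmu. assert (Hz : 0 < pi z) by (specialize (Hstar_le z); lra).
  unfold variance, expect, rho_col, rho, gfun, rel_var.
  rewrite (sumS_ext l (fun x => pi x * (P x z / mu z)) (fun x => / mu z * (pi x * P x z)))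
    by (intros; unfold Rdiv; ring).
  rewrite sumS_scal, (proj2 Hpi).
  rewrite (sumS_ext l _ (fun x => / mu z ^ 2 * (pi x * (P x z - pi z) ^ 2)))
    by (intros; field; lra).
  rewrite sumS_scal. field. lra.
Qed.

Context (T K : nat) (b eps : R).
Hypothesis HT : (1 <= T)%nat.
Hypothesis HK : (1 <= K)%nat.
Hypothesis Hmix : forall x y, Pn dec l P (4 * K * T) x y <= pi y + (/ 2) ^ (4 * K).
Hypothesis Hb : forall x, P x z <= b.
Hypothesis Heps0 : 0 < eps.
Hypothesis Heps : eps <= / 2.
Hypothesis Heps_V : 2 * b * eps <= rel_var l P pi z * pi z.
Hypothesis HK_small : (/ 2) ^ K <= pstar * (eps ^ 2 / (6 * rel_var l P pi z)).

Local Notation V := (rel_var l P pi z).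
Local Notation L := (4 * K * T)%nat.

(** The largest tau for which the second-order terms stay below the gain: 144 tau (1 + L V) =
    eps. *)
Definition full_tilt : R := eps / (144 * (1 + INR L * V)).

Lemma pi_le_bound : pi z <= b.
Proof.
  rewrite <- (proj2 Hpi z). rewrite <- (Rmult_1_r b), <- (proj2 (proj1 Hpi)), <- sumS_scal.
  apply sumS_le; intros x _. rewrite Rmult_comm. apply Rmult_le_compat_r; [apply Hpi|apply Hb].
Qed.

Lemma eps_le_rel_var : 2 * eps <= V.
Proof.
  pose proof pi_le_bound. specialize (Hstar_le z).
  apply (Rmult_le_reg_r (pi z)); nra.
Qed.

Lemma block_length_ge1 : 1 <= INR L.
Proof.
  apply (le_INR 1). apply (Nat.mul_le_mono 1 (4 * K) 1 T); [lia|exact HT].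
Qed.

Lemma full_tilt_pos : 0 < full_tilt.
Proof.
  pose proof eps_le_rel_var. pose proof block_length_ge1.
  apply Rdiv_lt_0_compat; [assumption|]. nra.
Qed.

(** With x = eps^2/V, the choice of K gives (1/2)^(4K) <= (pstar x/6)^4. The lower bound on tau
    involves pstar/2 because the first draw may force a tilt below [full_tilt]. *)
Lemma block_error_small tau : 0 < tau -> Rmin full_tilt (pstar / 2) <= tau ->
  16 * ((/ 2) ^ (4 * K) / pstar) <= INR L * tau * eps.
Proof.
  intros Htau0 Htau.
  pose proof eps_le_rel_var as HV. pose proof block_length_ge1 as HL.
  set (v := V) in *.
  set (x := eps ^ 2 / v).
  assert (Hxv : x * v = eps ^ 2) by (unfold x; field; lra).
  assert (Hx0 : 0 < x) by (unfold x; apply Rdiv_lt_0_compat; [apply pow_lt|]; lra).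
  assert (Hx : x <= eps / 2) by (apply (Rmult_le_reg_r v); [lra|]; rewrite Hxv; nra).
  assert (Hy : (/ 2) ^ (4 * K) <= (pstar * (x / 6)) ^ 4).
  { rewrite Nat.mul_comm, pow_mult. apply pow_incr. split; [apply pow_le; lra|].
    eapply Rle_trans; [exact HK_small|]. right. unfold x. field. lra. }
  assert (Herr : (/ 2) ^ (4 * K) / pstar <= pstar * (x ^ 4 / 1296)).
  { apply (Rmult_le_reg_r pstar); [assumption|].
    unfold Rdiv at 1. rewrite Rmult_assoc, Rinv_l, Rmult_1_r by lra.
    eapply Rle_trans; [exact Hy|].
    assert (Hp4 : pstar ^ 4 <= pstar ^ 2).
    { assert (0 <= pstar ^ 2 <= 1) by nra. nra. }
    replace ((pstar * (x / 6)) ^ 4) with (pstar ^ 4 * (x ^ 4 / 1296)) by field.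
    replace (pstar * (x ^ 4 / 1296) * pstar) with (pstar ^ 2 * (x ^ 4 / 1296)) by ring.
    apply Rmult_le_compat_r; [|exact Hp4].
    assert (0 < x ^ 4) by now apply pow_lt. lra. }
  assert (Hx2 : x ^ 2 <= eps ^ 2 / 4) by nra.
  assert (Hx3 : x ^ 3 <= / 64).
  { assert (0 <= x ^ 2 <= / 16) by nra. assert (x <= / 4) by lra.
    replace (x ^ 3) with (x ^ 2 * x) by ring. nra. }
  assert (Hx4 : 0 <= x ^ 4) by (apply pow_le; lra).
  assert (Hx40 : x ^ 4 <= x * / 64) by (replace (x ^ 4) with (x * x ^ 3) by ring; nra).
  assert (Hx41 : x ^ 4 <= eps ^ 2 / 64).
  { replace (x ^ 4) with (x ^ 2 * x ^ 2) by ring.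
    assert (0 <= x ^ 2 <= / 16) by nra. nra. }
  assert (Hx4v : x ^ 4 * v <= eps ^ 2 / 64).
  { replace (x ^ 4 * v) with (x ^ 3 * (x * v)) by ring. rewrite Hxv.
    assert (0 < eps ^ 2) by (apply pow_lt; lra). nra. }
  apply Rle_trans with (16 * (pstar * (x ^ 4 / 1296))); [lra|].
  assert (Hmin : 16 * (pstar * (x ^ 4 / 1296)) <= INR L * Rmin full_tilt (pstar / 2) * eps).
  { apply Rmin_case.
    - apply Rle_trans with (eps ^ 2 / (144 * (1 + v))).
      + apply (Rmult_le_reg_r (144 * (1 + v))); [nra|].
        replace (eps ^ 2 / (144 * (1 + v)) * (144 * (1 + v))) with (eps ^ 2) by (field; lra).
        assert (pstar * (x ^ 4 * (1 + v)) <= 1 * (x ^ 4 * (1 + v))).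
        { apply Rmult_le_compat_r; [|lra]. apply Rmult_le_pos; [exact Hx4|lra]. }
        lra.
      (* Since L >= 1, L / (1 + L V) >= 1 / (1 + V), which makes the bound independent of the block
         length. *)
      + unfold full_tilt. fold v.
        replace (INR L * (eps / (144 * (1 + INR L * v))) * eps)
          with (eps ^ 2 * (INR L / (144 * (1 + INR L * v)))) by (field; nra).
        apply Rmult_le_compat_l; [apply pow2_ge_0|].
        apply (Rmult_le_reg_r (144 * (1 + v))); [nra|]. rewrite Rinv_l by nra.
        apply (Rmult_le_reg_r (144 * (1 + INR L * v))); [nra|].
        replace (INR L / (144 * (1 + INR L * v)) * (144 * (1 + v)) * (144 * (1 + INR L * v)))
          with (INR L * (144 * (1 + v)) * 1) by (field; nra).
        nra.
    - assert (pstar * (x ^ 4 / 1296) <= pstar * (eps / 1000)).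
      { apply Rmult_le_compat_l; lra. }
      assert (0 < pstar * eps) by (apply Rmult_lt_0_compat; lra). nra. }
  eapply Rle_trans; [exact Hmin|].
  apply Rmult_le_compat_r; [lra|]. apply Rmult_le_compat_l; lra.
Qed.

Lemma chain_tail tau s alpha n m N :
  s = 1 \/ s = - 1 -> 0 < tau -> tau <= full_tilt -> Rmin full_tilt (pstar / 2) <= tau ->
  s * tau * nu z <= pi z / 2 ->
  n * eps / 2 - 1 <= s * (alpha - INR m) -> 0 <= alpha -> alpha <= 2 * n -> INR m <= 2 * n ->
  run_mean l (pstar / 2) (chain_kernel P nu) N (fun g => ind ((S m <= length (succs g))%nat /\
     0 <= s * (INR (fails dec z (S m) g) - pi z * ((1 - pstar / 2) / (pstar / 2)) * alpha)))
  <= 2 * exp 2 * exp (- (n * tau * eps / 4)).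
Proof.
  intros Hs Htau0 Htau Htau_min Hnz Hal Hal0 Hal2 Hm2.
  pose proof eps_le_rel_var as HV. pose proof block_length_ge1 as HL.
  pose proof pi_le_bound as Hpb. pose proof (Hstar_le z) as Hsz.
  assert (Hz : 0 < pi z) by lra.
  assert (HLV : 144 * tau * (1 + INR L * V) <= eps).
  { apply Rle_trans with (144 * full_tilt * (1 + INR L * V)).
    - apply Rmult_le_compat_r; nra.
    - right. unfold full_tilt. field. nra. }
  apply (chain_fails_tail dec l P pi nu Hl HP Hpi Hnu z Hz (pstar / 2) L
           ((/ 2) ^ (4 * K) / pstar) b); try assumption;
    lazymatch goal with |- forall _, _ => idtac | _ => try lra end.
  - destruct K, T; lia.
  - apply Rmult_le_pos; [apply pow_le; lra|]. left. now apply Rinv_0_lt_compat.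
  - intros x y. eapply Rle_trans; [apply Hmix|].
    assert (Hq : 0 <= (/ 2) ^ (4 * K) / pstar).
    { apply Rmult_le_pos; [apply pow_le; lra|]. left. now apply Rinv_0_lt_compat. }
    assert (E : (/ 2) ^ (4 * K) = (/ 2) ^ (4 * K) / pstar * pstar) by (field; lra).
    specialize (Hstar_le y). nra.
  (* After multiplication by V, L tau V <= eps/144 reduces the claim to 2 b eps <= V pi z, the
     condition on eps. *)
  - apply (Rmult_le_reg_r V); [lra|].
    assert (H1 : INR L * tau * V <= eps / 144) by nra.
    replace (8 * INR L * tau * b * V) with (8 * b * (INR L * tau * V)) by ring.
    apply Rle_trans with (8 * b * (eps / 144)).
    + apply Rmult_le_compat_l; lra.
    + assert (0 < V * pi z) by (apply Rmult_lt_0_compat; lra). lra.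
  - now apply block_error_small.
Qed.
End TiltChoice.

Lemma stationary_Pn {St} (dec : forall x y : St, {x = y} + {x <> y}) l (pi : St -> R) x y :
  finite_enum l -> Pn dec l (fun _ => pi) 1 x y = pi y.
Proof.
  intro Hl. cbn [Pn]. rewrite (sumS_single l _ x); try apply Hl.
  - destruct (dec x x); [ring|easy].
  - intros z _ Hz. destruct (dec x z); [now subst|ring].
Qed.

(** An i.i.d. sequence is the chain whose rows all equal pi: L = 1, no mixing error, relative
    variance 0, so the tilt eps/144 is allowed. *)
Lemma iid_tail {St} (dec : forall x y : St, {x = y} + {x <> y}) l (pi : St -> R)
    (z : St) (d eps s alpha n : R) m N :
  finite_enum l -> is_distribution l pi -> 0 < pi z ->
  0 < d -> d <= / 2 -> 2 * d <= pi z -> 0 < eps -> eps <= / 2 -> s = 1 \/ s = - 1 ->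
  n * eps / 2 - 1 <= s * (alpha - INR m) -> 0 <= alpha -> alpha <= 2 * n -> INR m <= 2 * n ->
  run_mean l d (chain_kernel (fun _ => pi) pi) N (fun g => ind ((S m <= length (succs g))%nat /\
     0 <= s * (INR (fails dec z (S m) g) - pi z * ((1 - d) / d) * alpha)))
  <= 2 * exp 2 * exp (- (n * (eps / 144) * eps / 4)).
Proof.
  intros Hl Hpi Hz Hd0 Hd Hdz Heps0 Heps Hs Hal Hal0 Hal2 Hm2.
  assert (Hst : stochastic l (fun _ => pi)) by (split; intros; apply Hpi).
  assert (Hinv : invariant l (fun _ => pi) pi).
  { split; [exact Hpi|]. intro y. rewrite sumS_scal_r, (proj2 Hpi). ring. }
  assert (HV : rel_var l (fun _ => pi) pi z = 0).
  { unfold rel_var. rewrite (sumS_ext l _ (fun _ => 0)) by (intros; ring).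
    rewrite sumS_zero. unfold Rdiv. ring. }
  apply (chain_fails_tail dec l (fun _ => pi) pi pi Hl Hst Hinv Hpi z Hz d 1 0 (pi z));
    try assumption; rewrite ?HV; cbn [INR];
    lazymatch goal with |- forall _, _ => idtac | _ => try lra; try lia; try nra end.
  - intros x y. rewrite stationary_Pn by assumption. lra.
  - intros _. apply Rle_refl.
Qed.

(** According to whether L V exceeds 1, 1 + L V is at most 2 L V or 2; the two cases yield the third
    and the first term of the theorem. The constant is 9216 = 4 * 144 * 2 * 8. *)
Lemma exp_rate_split (n eps V L k T : R) :
  0 <= n -> 0 < eps -> 0 < V -> 0 < k -> 0 < T -> 0 < L -> L <= 8 * k * T ->
  exp (- (n * (eps / (144 * (1 + L * V))) * eps / 4))
  <= exp (- (/ 9216) * n * eps ^ 2) + exp (- (/ 9216 * eps ^ 2 / V) * (n / (k * T))).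
Proof.
  intros Hn Heps HV Hk HT HL HLk.
  assert (HLV : 0 < L * V) by now apply Rmult_lt_0_compat.
  assert (He2 : 0 <= n * eps ^ 2) by (apply Rmult_le_pos; [lra|apply pow2_ge_0]).
  replace (n * (eps / (144 * (1 + L * V))) * eps / 4)
    with (n * eps ^ 2 * / (576 * (1 + L * V))) by (field; lra).
  pose proof (exp_pos (- (/ 9216) * n * eps ^ 2)).
  pose proof (exp_pos (- (/ 9216 * eps ^ 2 / V) * (n / (k * T)))).
  destruct (Rle_lt_dec (L * V) 1) as [C|C].
  - assert (exp (- (n * eps ^ 2 * / (576 * (1 + L * V)))) <= exp (- (/ 9216) * n * eps ^ 2)); [|lra].
    apply exp_le_mono.
    assert (/ 9216 <= / (576 * (1 + L * V))) by (apply Rinv_le_contravar; lra). nra.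
  - assert (exp (- (n * eps ^ 2 * / (576 * (1 + L * V))))
            <= exp (- (/ 9216 * eps ^ 2 / V) * (n / (k * T)))); [|lra].
    apply exp_le_mono.
    replace (- (/ 9216 * eps ^ 2 / V) * (n / (k * T)))
      with (- (n * eps ^ 2 * / (9216 * (k * T * V)))) by (field; repeat split; lra).
    apply Ropp_le_contravar, Rmult_le_compat_l; [exact He2|].
    apply Rinv_le_contravar; [nra|]. nra.
Qed.

Lemma run_mean_few_fails {St} (dec : forall x y : St, {x = y} + {x <> y}) l d K z m a N B :
  0 < d < 1 -> kernel l K ->
  run_mean l d K N (fun g => ind ((m <= length (succs g))%nat /\
     0 <= - 1 * (INR (fails dec z m g) - a))) <= B ->
  run_mean l d K N (fun g => ind (few_fails dec z m a g)) <= B.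
Proof.
  intros Hd HK H. eapply Rle_trans; [|exact H].
  apply run_mean_le; [exact Hd|exact HK|]. intro g. apply ind_le.
  intros [H1 H2]. split; [exact H1|lra].
Qed.

Lemma run_mean_many_fails {St} (dec : forall x y : St, {x = y} + {x <> y}) l d K z m a N B :
  0 < d < 1 -> kernel l K ->
  run_mean l d K N (fun g => ind ((m <= length (succs g))%nat /\
     0 <= 1 * (INR (fails dec z m g) - a))) <= B ->
  run_mean l d K N (fun g => ind (many_fails dec z m a g)) <= B.
Proof.
  intros Hd HK H. eapply Rle_trans; [|exact H].
  apply run_mean_le; [exact Hd|exact HK|]. intro g. apply ind_le.
  intros [H1 H2]. split; [exact H1|lra].
Qed.

Lemma half_pow_le (k y : R) (K : nat) :
  0 < y -> - log2 y <= k -> k <= INR K -> (/ 2) ^ K <= y.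
Proof.
  intros Hy Hk HK. rewrite <- Rpower_pow by lra. unfold Rpower. rewrite ln_Rinv by lra.
  assert (H2 : 0 < ln 2) by (rewrite <- ln_1; apply ln_increasing; lra).
  rewrite <- (exp_ln y) by assumption. apply exp_le_mono.
  unfold log2 in Hk.
  assert (E : ln y = ln y / ln 2 * ln 2) by (field; lra). rewrite E. nra.
Qed.

Lemma not_good_event {Omega St : Type} (Z U : nat -> Omega -> St) n eps m1 m2 :
  (forall i, INR i <= INR n * (1 - eps) <-> (i < S m1)%nat) ->
  (forall i, INR i <= INR n * (1 + eps) <-> (i < S m2)%nat) ->
  (fun w => ~ good_event Z U n eps w)
  = (fun w => missed Z U (S n) (S m1) w \/ missed U Z (S m2) (S n) w).
Proof.
  intros H1 H2. apply event_ext. intro w. unfold good_event, missed. split.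
  - intro H. apply NNPP. intro H'. apply H. split.
    + intros i Hi. apply NNPP. intro Hn. apply H'. left. exists i.
      split; [now apply H1|]. intros j Hj E. apply Hn. exists j. split; [lia|exact E].
    + intros j Hj. apply NNPP. intro Hn. apply H'. right. exists j.
      split; [lia|]. intros i Hi E. apply Hn. exists i. split; [now apply H2|exact E].
  - intros [[i [Hi H]]|[j [Hj H]]] [G1 G2].
    + destruct (G1 i) as [j [Hj E]]; [now apply H1|]. apply (H j); [lia|exact E].
    + destruct (G2 j) as [i [Hi E]]; [lia|]. apply (H i); [now apply H2|exact E].
Qed.

(** * Translation into the quantities of the theorem *)

Section FinalBound.
Context {St : Type} (dec : forall x y : St, {x = y} + {x <> y}) (l : list St)
  (P : St -> St -> R) (pi nu mu : St -> R).
Hypothesis Hl : finite_enum l.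
Hypothesis HP : stochastic l P.
Hypothesis Hpi : invariant l P pi.
Hypothesis Hnu : is_distribution l nu.
Hypothesis Hmu : forall x, 0 < mu x.
Context (T : nat) (eps : R).
Hypothesis HT : is_mixing_time dec l P pi T.
Hypothesis Hpos : forall x, 0 < pi x.
Hypothesis Heps0 : 0 < eps.
Hypothesis Heps_le : eps <= / 2.
Hypothesis Heps : forall z, eps <= variance l pi (rho_col P mu z)
                          / (2 * supnorm l (rho_col P mu z) * gfun pi mu z).

Local Notation pstar := (pi_star l pi).
Local Notation V z := (rel_var l P pi z).
Local Notation k := (kfun l P pi mu eps).

(** The maximum of p(x,z) over x, expressed through the sup norm in the theorem. *)
Definition col_bound (z : St) : R := supnorm l (rho_col P mu z) * mu z.

Lemma col_le x z : P x z <= col_bound z.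
Proof.
  unfold col_bound. specialize (Hmu z).
  apply (Rmult_le_reg_r (/ mu z)); [now apply Rinv_0_lt_compat|].
  rewrite Rmult_assoc, Rinv_r, Rmult_1_r by lra.
  eapply Rle_trans; [|apply (maxS_ge l (fun y => Rabs (rho_col P mu z y)) x); apply Hl].
  apply Rle_abs.
Qed.

Lemma pi_star_le x : pstar <= pi x.
Proof. apply minS_le, Hl. Qed.

Lemma list_nonempty : l <> [].
Proof.
  intro E. destruct Hpi as [[_ H] _]. rewrite E, sumS_nil in H.
  exact (Rlt_not_eq 0 1 Rlt_0_1 H).
Qed.

Lemma pi_star_pos : 0 < pstar.
Proof. apply minS_pos; [exact list_nonempty|exact Hpos]. Qed.

Lemma pi_le_1 x : pi x <= 1.
Proof.
  rewrite <- (proj2 (proj1 Hpi)). apply (sumS_ge_term l pi); [|apply Hl].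
  intros; apply Hpi.
Qed.

Lemma eps_rel_var z : 2 * col_bound z * eps <= V z * pi z.
Proof.
  pose proof (Hmu z) as Hm. pose proof (Hpos z) as Hz.
  pose proof (pi_le_bound l P pi Hpi z _ (fun x => col_le x z)) as Hb.
  specialize (Heps z).
  rewrite (variance_rho l P pi Hpi z pstar pi_star_pos pi_star_le mu Hm) in Heps.
  replace (supnorm l (rho_col P mu z)) with (col_bound z / mu z) in Heps
    by (unfold col_bound; field; lra).
  unfold gfun in Heps.
  replace (V z * (pi z / mu z) ^ 2 / (2 * (col_bound z / mu z) * (pi z / mu z)))
    with (V z * pi z / (2 * col_bound z)) in Heps by (field; lra).
  apply (Rmult_le_compat_r (2 * col_bound z)) in Heps; [|lra].
  replace (V z * pi z / (2 * col_bound z) * (2 * col_bound z)) with (V z * pi z) in Heps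
    by (field; lra).
  lra.
Qed.

Lemma rel_var_ge z : 2 * eps <= V z.
Proof.
  apply (eps_le_rel_var l P pi Hpi z pstar pi_star_pos pi_star_le (col_bound z) eps).
  - intro x. apply col_le.
  - exact Heps0.
  - apply eps_rel_var.
Qed.

(** T = 0 would leave a single state and hence zero variance, against [rel_var_ge]. *)
Lemma mixing_time_pos (z : St) : (1 <= T)%nat.
Proof.
  destruct T as [|T']; [exfalso|lia].
  assert (Heq : forall x y : St, x = y).
  { intros x y. exact (mixing_time_0 dec l P pi Hl HP Hpi x y HT). }
  pose proof (rel_var_ge z) as H. unfold rel_var in H.
  rewrite (sumS_ext l _ (fun _ => 0)) in H.
  - rewrite sumS_zero in H. unfold Rdiv in H. lra.
  - intros x _. replace (P x z) with (pi z); [ring|].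
    rewrite <- (proj2 Hpi z).
    rewrite (sumS_ext l _ (fun y => pi y * P x z)) by (intros y _; now rewrite (Heq y x)).
    rewrite sumS_scal_r, (proj2 (proj1 Hpi)). ring.
Qed.

Lemma log_arg z : pstar * eps ^ 2 * gfun pi mu z ^ 2 / (6 * variance l pi (rho_col P mu z))
  = pstar * (eps ^ 2 / (6 * V z)).
Proof.
  pose proof (Hmu z). pose proof (Hpos z). pose proof (rel_var_ge z).
  rewrite (variance_rho l P pi Hpi z pstar pi_star_pos pi_star_le mu) by assumption.
  unfold gfun. field. lra.
Qed.

Lemma log_arg_bounds z : 0 < pstar * (eps ^ 2 / (6 * V z)) <= / 2.
Proof.
  pose proof (rel_var_ge z). pose proof pi_star_pos. pose proof (pi_star_le z).
  pose proof (pi_le_1 z).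
  assert (0 < eps ^ 2 / (6 * V z)) by (apply Rdiv_lt_0_compat; [apply pow_lt|]; lra).
  split; [now apply Rmult_lt_0_compat|].
  assert (eps ^ 2 / (6 * V z) <= / 2).
  { apply (Rmult_le_reg_r (6 * V z)); [lra|].
    unfold Rdiv. rewrite Rmult_assoc, Rinv_l by lra. nra. }
  nra.
Qed.

Lemma kfun_ge z : - log2 (pstar * (eps ^ 2 / (6 * V z))) <= k.
Proof.
  unfold kfun. rewrite <- log_arg. apply Ropp_le_contravar.
  apply (minS_le l (fun z => log2 (pi_star l pi * eps ^ 2 * gfun pi mu z ^ 2
                           / (6 * variance l pi (rho_col P mu z))))), Hl.
Qed.

Lemma kfun_ge_1 (z : St) : 1 <= k.
Proof.
  eapply Rle_trans; [|apply (kfun_ge z)].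
  pose proof (log_arg_bounds z) as [H1 H2].
  assert (Hln2 : 0 < ln 2) by (rewrite <- ln_1; apply ln_increasing; lra).
  unfold log2. apply (Rmult_le_reg_r (ln 2)); [assumption|].
  replace (- (ln (pstar * (eps ^ 2 / (6 * V z))) / ln 2) * ln 2)
    with (- ln (pstar * (eps ^ 2 / (6 * V z)))) by (field; lra).
  assert (ln (pstar * (eps ^ 2 / (6 * V z))) <= ln (/ 2)).
  { destruct H2 as [H2|H2]; [left; now apply ln_increasing|rewrite H2; lra]. }
  rewrite ln_Rinv in * by lra. lra.
Qed.

Context (n : nat).

Definition bad_term (c : R) (z : St) : R :=
    exp (- c * INR n * eps ^ 2)
  + exp_ratio_term c n eps (pi z) (nu z)
  + exp (- (c * eps ^ 2 * (gfun pi mu z) ^ 2 / variance l pi (rho_col P mu z))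
         * (INR n / (k * INR T))).

Lemma exp_ratio_term_nonneg c z : 0 <= exp_ratio_term c n eps (pi z) (nu z).
Proof. unfold exp_ratio_term. destruct Req_EM_T; [lra|left; apply exp_pos]. Qed.

(** As k >= 1, K <= 2 k, so the block length 4 K T is at most 8 k T. *)
Lemma bad_term_rates z K : (1 <= K)%nat -> INR K <= k + 1 ->
  exp (- (INR n * full_tilt l P pi z T K eps * eps / 4)) <= bad_term (/ 9216) z.
Proof.
  intros HK1 HK2. pose proof (rel_var_ge z). pose proof (kfun_ge_1 z) as Hk.
  pose proof (mixing_time_pos z) as HT1. pose proof (Hmu z). pose proof (Hpos z).
  assert (HTr : 1 <= INR T) by now apply (le_INR 1).
  assert (HKr : 1 <= INR K) by now apply (le_INR 1).
  assert (E : INR (4 * K * T) = 4 * INR K * INR T) by (rewrite !mult_INR; cbn [INR]; ring).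
  eapply Rle_trans.
  - apply (exp_rate_split (INR n) eps (V z) (INR (4 * K * T)) k (INR T)); try lra.
    + apply pos_INR.
    + rewrite E. nra.
    + rewrite E. apply Rmult_le_compat_r; lra.
  - unfold bad_term.
    rewrite (variance_rho l P pi Hpi z pstar pi_star_pos pi_star_le mu) by assumption.
    replace (/ 9216 * eps ^ 2 * gfun pi mu z ^ 2 / (V z * gfun pi mu z ^ 2))
      with (/ 9216 * eps ^ 2 / V z) by (unfold gfun; field; lra).
    pose proof (exp_ratio_term_nonneg (/ 9216) z). lra.
Qed.

Lemma bad_term_iid z : exp (- (INR n * (eps / 144) * eps / 4)) <= bad_term (/ 9216) z.
Proof.
  apply Rle_trans with (exp (- (/ 9216) * INR n * eps ^ 2)).
  - apply exp_le_mono. pose proof (pos_INR n).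
    assert (0 <= INR n * eps ^ 2) by (apply Rmult_le_pos; [assumption|apply pow2_ge_0]). lra.
  - unfold bad_term. pose proof (exp_ratio_term_nonneg (/ 9216) z).
    pose proof (exp_pos (- (/ 9216 * eps ^ 2 * gfun pi mu z ^ 2 / variance l pi (rho_col P mu z))
      * (INR n / (k * INR T)))). lra.
Qed.

Lemma bad_term_ratio z : nu z <> 0 ->
  exp (- (INR n * (pi z / (2 * nu z)) * eps / 4)) <= bad_term (/ 9216) z.
Proof.
  intro Hz. assert (0 < nu z) by (pose proof (proj1 Hnu z); lra).
  apply Rle_trans with (exp_ratio_term (/ 9216) n eps (pi z) (nu z)).
  - unfold exp_ratio_term. destruct Req_EM_T as [|_]; [easy|]. apply exp_le_mono.
    pose proof (pos_INR n). pose proof (Hpos z).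
    assert (0 <= INR n * eps * (pi z / nu z)).
    { apply Rmult_le_pos; [apply Rmult_le_pos; lra|]. left. now apply Rdiv_lt_0_compat. }
    replace (INR n * (pi z / (2 * nu z)) * eps / 4)
      with (INR n * eps * (pi z / nu z) / 8) by (field; lra). lra.
  - unfold bad_term. pose proof (exp_pos (- (/ 9216) * INR n * eps ^ 2)).
    pose proof (exp_pos (- (/ 9216 * eps ^ 2 * gfun pi mu z ^ 2 / variance l pi (rho_col P mu z))
      * (INR n / (k * INR T)))). lra.
Qed.

(** The tilt is the smaller of [full_tilt] and pi z / (2 nu z), the latter imposed by the first
    draw; each alternative produces its own term of the bound. When nu z = 0 the first draw imposes
    nothing. *)
Lemma chain_tail_bad_term z s alpha N :
  s = 1 \/ s = - 1 -> INR n * eps / 2 - 1 <= s * (alpha - INR n) ->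
  0 <= alpha -> alpha <= 2 * INR n ->
  run_mean l (pstar / 2) (chain_kernel P nu) N (fun g => ind ((S n <= length (succs g))%nat /\
     0 <= s * (INR (fails dec z (S n) g) - pi z * ((1 - pstar / 2) / (pstar / 2)) * alpha)))
  <= 2 * exp 2 * bad_term (/ 9216) z.
Proof.
  intros Hs Hal Hal0 Hal2.
  pose proof (kfun_ge_1 z) as Hk1. pose proof (pos_INR n) as Hn0.
  destruct (nat_ceil k ltac:(lra)) as [K [HK1 HK2]].
  assert (HK : (1 <= K)%nat).
  { apply INR_le. cbn [INR]. lra. }
  pose proof (mixing_time_pos z) as HT1.
  pose proof pi_star_pos as Hp0.
  pose proof (pi_star_le z) as Hpz. pose proof (pi_le_1 z) as Hpz1.
  assert (Hp1 : pstar <= 1) by lra.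
  assert (Hmix : forall x y, Pn dec l P (4 * K * T) x y <= pi y + (/ 2) ^ (4 * K)).
  { intros x y. pose proof (Pn_near_invariant dec l P pi Hl HP Hpi T (4 * K) x y HT ltac:(lia)) as H.
    apply Rle_trans with (pi y + Rabs (Pn dec l P (4 * K * T) x y - pi y)); [|lra].
    pose proof (Rle_abs (Pn dec l P (4 * K * T) x y - pi y)). lra. }
  assert (HKs : (/ 2) ^ K <= pstar * (eps ^ 2 / (6 * V z))).
  { apply half_pow_le with k; [apply log_arg_bounds|apply kfun_ge|exact HK1]. }
  set (t0 := full_tilt l P pi z T K eps).
  assert (Ht0 : 0 < t0).
  { apply (full_tilt_pos l P pi Hpi z pstar Hp0 pi_star_le T K (col_bound z)); try assumption.
    - intro x; apply col_le.
    - apply eps_rel_var. }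
  assert (Htail : forall tau, 0 < tau -> tau <= t0 -> Rmin t0 (pstar / 2) <= tau ->
     s * tau * nu z <= pi z / 2 ->
     run_mean l (pstar / 2) (chain_kernel P nu) N (fun g => ind ((S n <= length (succs g))%nat /\
       0 <= s * (INR (fails dec z (S n) g) - pi z * ((1 - pstar / 2) / (pstar / 2)) * alpha)))
     <= 2 * exp 2 * exp (- (INR n * tau * eps / 4))).
  { intros tau H1 H2 H3 H4.
    apply (chain_tail dec l P pi nu Hl HP Hpi Hnu z pstar Hp0 pi_star_le Hp1 T K (col_bound z) eps);
      try assumption.
    - intro x; apply col_le.
    - apply eps_rel_var.
    - lra. }
  assert (He2 : 0 < 2 * exp 2) by (pose proof (exp_pos 2); lra).
  destruct (Req_EM_T (nu z) 0) as [Hz|Hz].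
  - eapply Rle_trans; [apply (Htail t0); try lra|].
    + apply Rmin_l.
    + rewrite Hz. lra.
    + apply Rmult_le_compat_l; [lra|]. now apply bad_term_rates.
  - assert (Hnz : 0 < nu z) by (pose proof (proj1 Hnu z); lra).
    assert (Hnz1 : nu z <= 1).
    { rewrite <- (proj2 Hnu). apply (sumS_ge_term l nu); [intros; apply Hnu|apply Hl]. }
    assert (Hr0 : 0 < pi z / (2 * nu z)) by (apply Rdiv_lt_0_compat; lra).
    (* Since nu z <= 1, a tilt cut down by the first draw still meets the lower bound required by
       [block_error_small]. *)
    assert (Hrp : pstar / 2 <= pi z / (2 * nu z)).
    { apply (Rmult_le_reg_r (2 * nu z)); [lra|].
      replace (pi z / (2 * nu z) * (2 * nu z)) with (pi z) by (field; lra). nra. }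
    assert (Hrn : pi z / (2 * nu z) * nu z = pi z / 2) by (field; lra).
    set (t1 := Rmin t0 (pi z / (2 * nu z))).
    assert (Ht1 : t1 <= t0) by apply Rmin_l.
    assert (Ht1' : t1 <= pi z / (2 * nu z)) by apply Rmin_r.
    assert (Ht1p : 0 < t1) by now apply Rmin_glb_lt.
    eapply Rle_trans; [apply (Htail t1); try assumption|].
    + unfold t1. apply Rmin_glb; [apply Rmin_l|].
      eapply Rle_trans; [apply Rmin_r|exact Hrp].
    + assert (t1 * nu z <= pi z / 2).
      { rewrite <- Hrn. apply Rmult_le_compat_r; lra. }
      assert (0 < t1 * nu z) by now apply Rmult_lt_0_compat.
      destruct Hs as [-> | ->]; lra.
    + apply Rmult_le_compat_l; [lra|]. unfold t1. apply Rmin_case.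
      * now apply bad_term_rates.
      * now apply bad_term_ratio.
Qed.

Lemma iid_tail_bad_term z s alpha m N :
  s = 1 \/ s = - 1 -> INR n * eps / 2 - 1 <= s * (alpha - INR m) ->
  0 <= alpha -> alpha <= 2 * INR n -> INR m <= 2 * INR n ->
  run_mean l (pstar / 2) (chain_kernel (fun _ => pi) pi) N
    (fun g => ind ((S m <= length (succs g))%nat /\
     0 <= s * (INR (fails dec z (S m) g) - pi z * ((1 - pstar / 2) / (pstar / 2)) * alpha)))
  <= 2 * exp 2 * bad_term (/ 9216) z.
Proof.
  intros Hs Hal Hal0 Hal2 Hm.
  pose proof pi_star_pos. pose proof (pi_star_le z). pose proof (pi_le_1 z).
  eapply Rle_trans.
  - apply (iid_tail dec l pi z (pstar / 2) eps s alpha (INR n) m N); try assumption; try lra.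
    apply Hpi.
  - apply Rmult_le_compat_l; [pose proof (exp_pos 2); lra|]. apply bad_term_iid.
Qed.
End FinalBound.

Theorem theorem3p1 :
  exists c C : R, 0 < c /\ 0 < C /\
  forall (S : Type) (dec : forall x y : S, {x = y} + {x <> y}) (l : list S)
         (P : S -> S -> R) (pi nu mu : S -> R),
    finite_enum l ->
    stochastic l P ->
    irreducible dec l P ->
    invariant l P pi ->
    is_distribution l nu ->
    (forall x, 0 < mu x) ->
    exists (Omega : Type) (F : (Omega -> Prop) -> Prop) (Q : (Omega -> Prop) -> R)
           (Z U : nat -> Omega -> S),
      prob_space F Q /\
      markov_chain F Q P nu Z /\
      iid_seq F Q pi U /\
      forall (T : nat), is_mixing_time dec l P pi T ->
      forall (eps : R) (n : nat),
        0 < eps ->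
        eps <= / 2 ->
        (forall z, eps <= variance l pi (rho_col P mu z)
                          / (2 * supnorm l (rho_col P mu z) * gfun pi mu z)) ->
        2 * kfun l P pi mu eps * INR T <= INR n ->
        F (fun w => ~ good_event Z U n eps w) /\
        Q (fun w => ~ good_event Z U n eps w)
        <= C * sumS l (fun z =>
                 exp (- c * INR n * eps ^ 2)
               + exp_ratio_term c n eps (pi z) (nu z)
               + exp (- (c * eps ^ 2 * (gfun pi mu z) ^ 2
                         / variance l pi (rho_col P mu z))
                      * (INR n / (kfun l P pi mu eps * INR T)))).
Proof.
  (* Two inclusions, each with two tails bounded by 2 exp 2 times the summand, give 8 exp 2. *)
  exists (/ 9216), (8 * exp 2). split; [lra|]. split; [pose proof (exp_pos 2); lra|].
  intros St dec l P pi nu mu Hl HP Hirr Hpi Hnu Hmu.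
  assert (Hpos := invariant_pos dec l P pi Hl HP Hpi Hirr).
  assert (Hp0 := pi_star_pos l P pi Hpi Hpos).
  (* Some state is needed as the default value of [visit]. *)
  destruct l as [|x0 l0] eqn:El; [now destruct (list_nonempty [] P pi Hpi)|].
  rewrite <- El in *. clear El l0.
  assert (Hp1 : pi_star l pi <= 1).
  { eapply Rle_trans; [apply (pi_star_le l pi Hl x0)|apply (pi_le_1 l P pi Hl Hpi)]. }
  set (d := pi_star l pi / 2).
  assert (Hd : 0 < d < 1) by (unfold d; lra).
  assert (Hpi' : invariant l (fun _ => pi) pi).
  { split; [apply Hpi|]. intro y. rewrite sumS_scal_r, (proj2 (proj1 Hpi)). ring. }
  assert (HKZ := chain_kernel_kernel l P nu HP Hnu).
  assert (HKU : kernel l (chain_kernel (fun _ => pi) pi)).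
  { apply chain_kernel_kernel; [split; intros|]; apply Hpi. }
  destruct (soft_local_time_coupling dec l d x0 Hl Hd _ _ HKZ HKU)
    as [Omega [F [Q [Z [U [HQ [[HZ1 HZ2] [[HU1 HU2] Hmiss]]]]]]]].
  exists Omega, F, Q, Z, U. split; [exact HQ|]. split; [|split].
  - split; [exact HZ1|]. exact HZ2.
  - split; [exact HU1|]. intros m us. rewrite HU2. cbn [chain_kernel]. clear.
    induction m as [|m IH]; cbn [prodn]; [ring|]. rewrite <- Rmult_assoc, IH. reflexivity.
  - intros T HT eps n Heps0 Heps_le Heps _.
    pose proof (pos_INR n) as Hn.
    destruct (nat_count_below (INR n * (1 - eps))) as [m1 [Hm1 [_ Hc1]]];
      [apply Rmult_le_pos; lra|].
    destruct (nat_count_below (INR n * (1 + eps))) as [m2 [Hm2 [Hm2' Hc2]]];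
      [apply Rmult_le_pos; lra|].
    rewrite (not_good_event Z U n eps m1 m2 Hc1 Hc2).
    destruct (Hmiss (S n) (S m1)) as [[HF1 HB1] _].
    destruct (Hmiss (S n) (S m2)) as [_ [HF2 HB2]].
    split; [now apply (F_or F Q HQ)|].
    set (c := pi_star l pi). fold c in d.
    set (bt := bad_term l P pi nu mu T eps n (/ 9216)).
    assert (Hne : 0 <= INR n * eps <= INR n * / 2).
    { split; [apply Rmult_le_pos; lra|apply Rmult_le_compat_l; lra]. }
    eapply Rle_trans; [apply (Q_or_le F Q HQ); assumption|].
    apply Rle_trans with (sumS l (fun z => 2 * exp 2 * bt z + 2 * exp 2 * bt z)
                          + sumS l (fun z => 2 * exp 2 * bt z + 2 * exp 2 * bt z)).
    + apply Rplus_le_compat.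
      (* pi z (1 - d)/d is the mean number of failures at z per draw from pi; the level is thus the
         mean for n(1 - eps/2) draws, halfway between the two runs. *)
      * apply (HB1 (fun z => pi z * ((1 - d) / d) * (INR n * (1 - eps / 2)))); intros z N.
        -- apply run_mean_few_fails; [exact Hd|exact HKZ|].
           apply (chain_tail_bad_term dec l P pi nu mu Hl HP Hpi Hnu Hmu T eps HT Hpos
                    Heps0 Heps_le Heps n z (- 1)); lra.
        -- apply run_mean_many_fails; [exact Hd|exact HKU|].
           apply (iid_tail_bad_term dec l P pi nu mu Hl Hpi T eps Hpos
                    Heps0 Heps_le n z 1); lra.
      (* Here [m2] may fall short of n(1 + eps) by almost 1, which the term -1 in the tail lemmas
         allows for. *)
      * apply (HB2 (fun z => pi z * ((1 - d) / d) * (INR n * (1 + eps / 2)))); intros z N.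
        -- apply run_mean_few_fails; [exact Hd|exact HKU|].
           apply (iid_tail_bad_term dec l P pi nu mu Hl Hpi T eps Hpos
                    Heps0 Heps_le n z (- 1)); lra.
        -- apply run_mean_many_fails; [exact Hd|exact HKZ|].
           apply (chain_tail_bad_term dec l P pi nu mu Hl HP Hpi Hnu Hmu T eps HT Hpos
                    Heps0 Heps_le Heps n z 1); lra.
    + right. rewrite <- sumS_plus, <- sumS_scal. apply sumS_ext; intros z _.
      change (exp (- (/ 9216) * INR n * eps ^ 2) + exp_ratio_term (/ 9216) n eps (pi z) (nu z)
        + exp (- (/ 9216 * eps ^ 2 * gfun pi mu z ^ 2 / variance l pi (rho_col P mu z))
               * (INR n / (kfun l P pi mu eps * INR T)))) with (bt z).
      ring.
Qed.
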